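(* Let $f,g:\mathbb{R}^n\to(-\infty,\infty]$ be proper convex functions with $g$ closed, let $h:\mathbb{R}^n\to\mathbb{R}$ be convex, and let $Y\subseteq\mathbb{R}^n$ be a nonempty closed convex set with $\mathrm{dom}(g)\subseteq Y\subseteq \mathrm{int}(\mathrm{dom}(f))$. Assume that $f$ is $L$-smooth over $Y$ and that $F:=f+g-h$ is bounded from below, i.e. there is a real $F^*$ with $F(\mathbf{x})\ge F^*$ for all $\mathbf{x}\in\mathbb{R}^n$. Let $\{\mathbf{x}^k\}$ be a sequence generated by the algorithm SPDCAe described in the context, with $L_k$ and $\beta_k$ chosen by one of the rules given there (non-monotone or monotone backtracking; contract or restart method), and suppose that the scaling matrices satisfy $$\mu \mathbf{I}\preceq \mathbf{D}_k,\qquad \mathbf{D}_{k+1}\preceq(1+\eta_k)\mathbf{D}_k,\qquad k=1,2,\dots,$$ for some $\mu>0$ and some nonnegative sequence $\{\eta_k\}$ with $\sum_{k=1}^\infty\eta_k<\infty$. Then: (i) the sequence $\{F(\mathbf{x}^k)\}$ converges and $\lim_{k\to\infty}\|\mathbf{x}^k-\mathbf{x}^{k-1}\|=0$; (ii) if $\{\mathbf{x}^k\}$ is bounded, then any limit point $\bar{\mathbf{x}}$ of $\{\mathbf{x}^k\}$ is a critical point of the problem $\min_{\mathbf{x}\in\mathbb{R}^n}F(\mathbf{x})$, i.e. $\mathbf{0}\in\nabla f(\bar{\mathbf{x}})+\partial g(\bar{\mathbf{x}})-\partial h(\bar{\mathbf{x}})$.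
   Context: **Notation.** $\|\cdot\|$ is the Euclidean norm. $\mathbb{S}^n_{++}$ is the set of symmetric positive definite $n\times n$ matrices. For $\mathbf{D}\in\mathbb{S}^n_{++}$, $\|\mathbf{u}\|_{\mathbf{D}}^2=\langle\mathbf{u},\mathbf{D}\mathbf{u}\rangle$. For symmetric matrices, $\mathbf{A}\preceq\mathbf{B}$ means that $\mathbf{B}-\mathbf{A}$ is positive semidefinite. $f$ is $L$-smooth over $Y$ if $f$ is differentiable at each point of $Y$ and $\|\nabla f(\mathbf{x})-\nabla f(\mathbf{y})\|\le L\|\mathbf{x}-\mathbf{y}\|$ for all $\mathbf{x},\mathbf{y}\in Y$. $\partial$ denotes the convex subdifferential. For a proper closed convex function $p$, $\mathrm{Prox}_p^{\mathbf{D}}(\mathbf{x})=\operatorname{argmin}_{\mathbf{u}\in\mathbb{R}^n}\{p(\mathbf{u})+\frac12\|\mathbf{u}-\mathbf{x}\|_{\mathbf{D}}^2\}$. $\Pi_Y^{\mathbf{D}}$ is the projection onto $Y$ in the norm $\|\cdot\|_{\mathbf{D}}$, i.e. $\Pi_Y^{\mathbf{D}}=\mathrm{Prox}^{\mathbf{D}}_{\delta_Y}$ with $\delta_Y$ the indicator function of $Y$. **Algorithm SPDCAe.** Input: $\eta>1$, $\underline{L}>0$, and $\mathbf{x}^0=\mathbf{x}^{-1}\in Y$. For $k=1,2,3,\dots$: compute any $\mathbf{h}^{k-1}\in\partial h(\mathbf{x}^{k-1})$ and pick an initial guess $L_k^{\mathrm{init}}\ge\underline{L}$. For $i=0,1,2,\dots$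 perform the trial 1. $L_k=\eta^iL_k^{\mathrm{init}}$ and $t_k=1/L_k$; 2. pick $\beta_k\in[0,1)$ and $\mathbf{D}_k\in\mathbb{S}^n_{++}$, and set $\mathbf{y}^k=\Pi_Y^{\mathbf{D}_k}\big(\mathbf{x}^{k-1}+\beta_k(\mathbf{x}^{k-1}-\mathbf{x}^{k-2})\big)$; 3. $\mathbf{x}^k=\mathrm{Prox}_{t_kg}^{\mathbf{D}_k}\big(\mathbf{y}^k-t_k\mathbf{D}_k^{-1}[\nabla f(\mathbf{y}^k)-\mathbf{h}^{k-1}]\big)$; until $f(\mathbf{x}^k)\le f(\mathbf{y}^k)+\langle\nabla f(\mathbf{y}^k),\mathbf{x}^k-\mathbf{y}^k\rangle+\frac1{2t_k}\|\mathbf{x}^k-\mathbf{y}^k\|_{\mathbf{D}_k}^2$ holds. The values of $L_k,t_k,\beta_k,\mathbf{D}_k,\mathbf{y}^k,\mathbf{x}^k$ from the accepted trial are the ones retained. The requirements on the scaling matrices $\mathbf{D}_k$ in the theorem apply to every matrix picked as $\mathbf{D}_k$ in step 2 (with the matrix of the previous iteration being the accepted one). **Choice of $L_k^{\mathrm{init}}$.** $L_1^{\mathrm{init}}\ge\underline{L}$ is arbitrary. - *Non-monotone backtracking:* fix a positive integer $T_1$ and $\rho\in(0,1)$. For $k\ge2$, $L_k^{\mathrm{init}}=L_{k-1}$ if $k$ is not divisible by $T_1$, and $L_k^{\mathrm{init}}=\max\{\rho L_{k-1},\underline{L}\}$ otherwise. - *Monotone backtracking:* $L_k^{\mathrm{init}}=L_{k-1}$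 for $k\ge2$. **Choice of $\beta_k$.** Consider the recursion $\theta_1=1$ and, for $l\ge2$, $$\theta_l=\frac{1+\sqrt{1+4\theta_{l-1}^2L_l/L_{l-1}}}{2}\ \text{ (non-monotone)},\qquad \theta_l=\frac{1+\sqrt{1+4\theta_{l-1}^2}}{2}\ \text{ (monotone)}.$$ In each trial of iteration $k$ the current trial value of $L_k$ is used. - *Contract method:* $\beta_1=0$ and $\beta_k=\delta\,\frac{\theta_{k-1}-1}{\theta_k}$ for $k\ge2$, with a fixed $\delta\in(0,1)$. - *Restart method:* fix a positive integer $T_2$. Set $\beta_1=0$ and $\beta_k=\frac{\theta_{k-1}-1}{\theta_k}$ for $k\ge2$, with $\theta_k$ given by the recursion, except that a restart occurs after iteration $k$ whenever the restart condition holds: then $\theta_{k+1}$ is reset to $1$ (with $\beta_{k+1}=0$, as at the first iteration) and the recursion continues from there. The restart condition is either ''$k$ is divisible by $T_2$'' (fixed restart scheme), or ''$k$ is divisible by $T_2$ or $\langle\mathbf{x}^k-\mathbf{x}^{k-1},\mathbf{y}^k-\mathbf{x}^k\rangle>0$'' (fixed and adaptive restart scheme). *)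

(* Defs.v *)
From mathcomp Require Import all_boot all_order all_algebra.
From mathcomp Require Import all_classical all_reals all_analysis.
Import Order.TTheory GRing.Theory Num.Theory.
Import numFieldNormedType.Exports.

Set Implicit Arguments.
Unset Strict Implicit.
Unset Printing Implicit Defensive.

Local Open Scope classical_set_scope.
Local Open Scope ring_scope.

(* Points of R^n are row vectors.  All matrices acting on them below are
   symmetric, so the row [u *m D] is the transpose of the column [D u].
   The library's norm [`|u|] on ['rV[R]_n] is the max norm; it induces the usual
   topology of R^n but it is not the Euclidean norm, which is [enorm]. *)

Section Euclidean.
Context {R : realType} {n : nat}.
Implicit Types (u v x : 'rV[R]_n) (A B D : 'M[R]_n).

Definition dotp u v : R := \sum_(i < n) u 0 i * v 0 i.

Definition enorm u : R := Num.sqrt (dotp u u).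

Definition sqnormD D u : R := dotp u (u *m D).

Definition psd A : Prop := A^T = A /\ forall u, 0 <= dotp u (u *m A).

Definition posdef A : Prop :=
  A^T = A /\ forall u, u != 0 -> 0 < dotp u (u *m A).

Definition loewner A B : Prop := psd (B - A).

End Euclidean.

Section ConvexAnalysis.
Context {R : realType} {n : nat}.
Implicit Types (p f : 'rV[R]_n -> \bar R) (Y : set 'rV[R]_n).

Definition edom p : set 'rV[R]_n := [set x | (p x < +oo)%E].

Definition eproper p : Prop := (forall x, p x != -oo%E) /\ edom p !=set0.

Definition econvex p : Prop :=
  forall (x y : 'rV[R]_n) (t : R), 0 <= t -> t <= 1 ->
    (p (t *: x + (1 - t) *: y)%R <= t%:E * p x + (1 - t)%:E * p y)%E.

Definition eclosed p : Prop :=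
  closed [set xa : 'rV[R]_n * R | (p xa.1 <= xa.2%:E)%E].

Definition subdiff p (x : 'rV[R]_n) : set 'rV[R]_n :=
  [set v | edom p x /\ forall y : 'rV[R]_n, (p x + (dotp v (y - x)%R)%:E <= p y)%E].

Definition indicator Y (x : 'rV[R]_n) : \bar R :=
  if x \in Y then 0%E else +oo%E.

Definition argmin p : set 'rV[R]_n := [set u | forall w, (p u <= p w)%E].

(* The set of minimizers, which is a singleton when [p] is proper closed convex
   and [D] is positive definite. *)
Definition prox p (D : 'M[R]_n) (x : 'rV[R]_n) : set 'rV[R]_n :=
  argmin (fun u => (p u + (2^-1 * sqnormD D (u - x)%R)%:E)%E).

Definition projD Y (D : 'M[R]_n) (x : 'rV[R]_n) : set 'rV[R]_n :=
  prox (indicator Y) D x.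

(* [grad] and [smooth_on] are only meant for points in the interior of
   [edom f], around which [fine \o f] coincides with [f]. *)
Definition grad f (x : 'rV[R]_n) : 'rV[R]_n :=
  \row_j 'D_(delta_mx 0 j) (fine \o f) x.

Definition smooth_on f (L : R) Y : Prop :=
  (forall x, Y x -> differentiable (fine \o f) x) /\
  (forall x y, Y x -> Y y -> enorm (grad f x - grad f y) <= L * enorm (x - y)).

Definition objective f p (h : 'rV[R]_n -> R) (x : 'rV[R]_n) : \bar R :=
  (f x + p x - (h x)%:E)%E.

Definition critical f p (h : 'rV[R]_n -> R) (x : 'rV[R]_n) : Prop :=
  exists u v, [/\ subdiff p x u, subdiff (EFin \o h) x v
    & 0 = grad f x + u - v].

End ConvexAnalysis.

(* The values of L_k, theta_k, beta_k, D_k, y^k, x^k computed in one trial. *)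
Record trial (R : realType) (n : nat) := Trial {
  tL : R;
  ttheta : R;
  tbeta : R;
  tD : 'M[R]_n;
  ty : 'rV[R]_n;
  tx : 'rV[R]_n }.

Variant backtracking (R : realType) :=
  | NonMonotone (T1 : nat) (rho : R)
  | Monotone.
Arguments Monotone {R}.

Variant restart_scheme := FixedRestart | FixedAdaptiveRestart.

Variant extrapolation (R : realType) :=
  | Contract (delta : R)
  | Restart (s : restart_scheme) (T2 : nat).
Arguments Restart {R}.

Section SPDCAe.
Context {R : realType} {n : nat}.
Implicit Types (f g : 'rV[R]_n -> \bar R) (h : 'rV[R]_n -> R).
Implicit Types (Y : set 'rV[R]_n) (T : trial R n) (x : nat -> 'rV[R]_n).
Implicit Types (tr : nat -> nat -> trial R n) (acc : nat -> nat).
Implicit Types (bt : backtracking R) (em : extrapolation R).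

(* Trial number [i] of an iteration started from [xp] = x^{k-1},
   [xpp] = x^{k-2} and the subgradient [hs] = h^{k-1}. *)
Definition trial_step f g Y (eta Linit : R) (xp xpp hs : 'rV[R]_n) (i : nat) T
    : Prop :=
  let t := 1 / tL T in
  [/\ tL T = eta ^+ i * Linit,
      0 <= tbeta T < 1,
      posdef (tD T),
      projD Y (tD T) (xp + tbeta T *: (xp - xpp)) (ty T)
    & prox (fun u => (t%:E * g u)%E) (tD T)
        (ty T - t *: ((grad f (ty T) - hs) *m invmx (tD T))) (tx T)].

Definition accepts f T : Prop :=
  let t := 1 / tL T in
  (f (tx T) <= f (ty T)
     + (dotp (grad f (ty T)) (tx T - ty T)
        + 1 / (2 * t) * sqnormD (tD T) (tx T - ty T))%R%:E)%E.

(* Iteration [k >= 1] performs the trials [tr k 0], ..., [tr k (acc k)] and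
   accepts the last one; entries [tr k i] with [acc k < i] are irrelevant.
   Truncated predecessors give [x 1.-2 = x 0], i.e. x^{-1} = x^0. *)
Definition spdcae f g h Y (eta Lmin : R) (Linit : nat -> R)
    (hs : nat -> 'rV[R]_n) tr acc x : Prop :=
  Y (x 0%N) /\
  forall k, (0 < k)%N ->
    [/\ subdiff (EFin \o h) (x k.-1) (hs k.-1),
        Lmin <= Linit k,
        forall i, (i <= acc k)%N ->
          trial_step f g Y eta (Linit k) (x k.-1) (x k.-2) (hs k.-1) i (tr k i),
        forall i, (i < acc k)%N -> ~ accepts f (tr k i)
      & accepts f (tr k (acc k)) /\ x k = tx (tr k (acc k))].

Definition backtracking_params bt : Prop :=
  match bt with
  | NonMonotone T1 rho => (0 < T1)%N /\ 0 < rho < 1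
  | Monotone => True
  end.

Definition Linit_rule bt (Lmin : R) (Linit : nat -> R) tr acc : Prop :=
  forall k, (2 <= k)%N ->
    let Lp := tL (tr k.-1 (acc k.-1)) in
    Linit k = match bt with
              | NonMonotone T1 rho =>
                  if (T1 %| k)%N then Num.max (rho * Lp) Lmin else Lp
              | Monotone => Lp
              end.

Definition extrapolation_params em : Prop :=
  match em with
  | Contract delta => 0 < delta < 1
  | Restart _ T2 => (0 < T2)%N
  end.

Definition theta_next bt (thetap Lp L : R) : R :=
  match bt with
  | NonMonotone _ _ => (1 + Num.sqrt (1 + 4 * thetap ^+ 2 * L / Lp)) / 2
  | Monotone => (1 + Num.sqrt (1 + 4 * thetap ^+ 2)) / 2
  end.

Definition restart_after em tr acc x (k : nat) : bool :=
  match em with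
  | Contract _ => false
  | Restart FixedRestart T2 => (T2 %| k)%N
  | Restart FixedAdaptiveRestart T2 =>
      (T2 %| k)%N ||
      (0 < dotp (x k - x k.-1) (ty (tr k (acc k)) - x k))
  end.

Definition momentum_factor em : R :=
  match em with Contract delta => delta | Restart _ _ => 1 end.

Definition beta_rule bt em tr acc x : Prop :=
  forall k i, (0 < k)%N -> (i <= acc k)%N ->
    let P := tr k.-1 (acc k.-1) in
    let T := tr k i in
    if (k == 1)%N || restart_after em tr acc x k.-1 then
      ttheta T = 1 /\ tbeta T = 0
    else
      ttheta T = theta_next bt (ttheta P) (tL P) (tL T) /\
      tbeta T = momentum_factor em * ((ttheta P - 1) / ttheta T).

Definition scaling_condition (mu : R) (etas : nat -> R) tr acc : Prop :=
  (forall k i, (0 < k)%N -> (i <= acc k)%N -> loewner mu%:M (tD (tr k i))) /\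
  (forall k i, (0 < k)%N -> (i <= acc k.+1)%N ->
     loewner (tD (tr k.+1 i)) ((1 + etas k) *: tD (tr k (acc k)))).

End SPDCAe.

(* Main.v *)
Require Import Defs.
From mathcomp Require Import all_boot all_order all_algebra.
From mathcomp Require Import all_classical all_reals all_analysis.
From mathcomp Require Import ring lra.
Import Order.TTheory GRing.Theory Num.Theory.
Import numFieldNormedType.Exports.
Local Open Scope classical_set_scope.
Local Open Scope ring_scope.

(* Write [a_k = L_k / 2 * |x^k - x^{k-1}|_{D_k}^2].  Testing the prox step at
   [x^{k-1}], the gradient inequality of f, the acceptance test and the
   subgradient of h give
     F(x^k) + a_k <= F(x^{k-1}) + L_k / 2 * |y^k - x^{k-1}|_{D_k}^2,
   and nonexpansiveness of the projection bounds the last term by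
   [L_k beta_k^2 / L_{k-1} * (1 + eta_{k-1}) * a_{k-1}].  The recursion
   [theta_k^2 - theta_k = theta_{k-1}^2 L_k / L_{k-1}] yields
   [L_k beta_k^2 <= kappa^2 L_{k-1}] with [kappa < 1]: kappa is delta for the
   contract method, and [1 - 1 / sup theta] for the restart method, where theta
   is bounded because the recursion runs for at most T2 steps.  As eta_k tends
   to 0, eventually [F(x^k) + a_k <= F(x^{k-1}) + c a_{k-1}] with [c < 1], so
   [F(x^k) + c a_k] decreases and is bounded below; this gives (i).  For (ii),
   pass to the limit in the optimality condition of the prox step along an
   ultrafilter refining the given subsequence: the L_k and D_k are bounded, so
   the term [L_k D_k (y^k - x^k)] vanishes, and the subgradients of h are
   bounded near the limit point. *)

(** * Inner product, weighted norms and the Cauchy-Schwarz inequality *)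

Section EuclideanTheory.
Context {R : realType} {n : nat}.
Implicit Types (u v w : 'rV[R]_n) (A B D : 'M[R]_n).

Lemma dotpE u v : dotp u v = (u *m v^T) 0 0.
Proof. by rewrite mxE; apply: eq_bigr => i _; rewrite mxE. Qed.

Lemma dotpC u v : dotp u v = dotp v u.
Proof. by apply: eq_bigr => i _; rewrite mulrC. Qed.

Lemma dotpDl u v w : dotp (u + v) w = dotp u w + dotp v w.
Proof. by rewrite !dotpE mulmxDl mxE. Qed.

Lemma dotpDr w u v : dotp w (u + v) = dotp w u + dotp w v.
Proof. by rewrite dotpC dotpDl !(dotpC _ w). Qed.

Lemma dotpZl (c : R) u w : dotp (c *: u) w = c * dotp u w.
Proof. by rewrite !dotpE -scalemxAl mxE. Qed.

Lemma dotpZr (c : R) w u : dotp w (c *: u) = c * dotp w u.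
Proof. by rewrite dotpC dotpZl dotpC. Qed.

Lemma dotpNl u w : dotp (- u) w = - dotp u w.
Proof. by rewrite -scaleN1r dotpZl mulN1r. Qed.

Lemma dotpNr w u : dotp w (- u) = - dotp w u.
Proof. by rewrite dotpC dotpNl dotpC. Qed.

Lemma dotp0r w : dotp w 0 = 0.
Proof. by rewrite -(scale0r 0) dotpZr mul0r. Qed.

Definition dotp_linear :=
  (dotpDl, dotpDr, dotpNl, dotpNr, dotpZl, dotpZr).

Lemma dotp_ge0 u : 0 <= dotp u u.
Proof. by apply: sumr_ge0 => i _; rewrite -expr2 sqr_ge0. Qed.

Lemma dotp_gt0 u : u != 0 -> 0 < dotp u u.
Proof.
move=> /matrix0Pn[i [j uij]]; rewrite (ord1 i) in uij.
rewrite /dotp (bigD1 j) //= ltr_wpDr ?sumr_ge0 // => [k _|].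
  by rewrite -expr2 sqr_ge0.
by rewrite -expr2 exprn_even_gt0.
Qed.

Lemma dotp_mulmx D u v : D^T = D -> dotp (u *m D) v = dotp (v *m D) u.
Proof.
move=> DT; rewrite dotpC !dotpE -[in LHS]DT; congr (_ _ 0 0).
by rewrite trmx_mul trmxK mulmxA.
Qed.

Lemma sqnormDE D u : sqnormD D u = dotp (u *m D) u.
Proof. exact: dotpC. Qed.

Lemma sqnormDD D u v : D^T = D ->
  sqnormD D (u + v) = sqnormD D u + 2 * dotp (u *m D) v + sqnormD D v.
Proof.
move=> DT; rewrite !sqnormDE mulmxDl !dotp_linear (dotp_mulmx D v u DT); ring.
Qed.

Lemma sqnormDZ D (c : R) u : sqnormD D (c *: u) = c ^+ 2 * sqnormD D u.
Proof. by rewrite !sqnormDE -scalemxAl !dotp_linear mulrA. Qed.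

Lemma sqnormDN D u : sqnormD D (- u) = sqnormD D u.
Proof. by rewrite -scaleN1r sqnormDZ sqrrN expr1n mul1r. Qed.

Lemma sqnormDC D u v : sqnormD D (u - v) = sqnormD D (v - u).
Proof. by rewrite -sqnormDN opprB. Qed.

Lemma sqnormD0 D : sqnormD D 0 = 0.
Proof. by rewrite sqnormDE dotp0r. Qed.

Lemma sqnormD_scalemx (c : R) D u : sqnormD (c *: D) u = c * sqnormD D u.
Proof. by rewrite !sqnormDE -scalemxAr dotpZl. Qed.

Lemma sqnormD_scalar (c : R) u : sqnormD c%:M u = c * dotp u u.
Proof. by rewrite sqnormDE mul_mx_scalar dotpZl. Qed.

Lemma posdef_ge0 D u : posdef D -> 0 <= sqnormD D u.
Proof.
move=> [_ Dp]; have [->|/Dp/ltW//] := eqVneq u 0.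
by rewrite sqnormD0.
Qed.

Lemma loewner_sqnormD A B u : loewner A B -> sqnormD A u <= sqnormD B u.
Proof.
by case=> _ /(_ u); rewrite mulmxBr dotpDr dotpNr subr_ge0.
Qed.

Lemma posdef1 : posdef (1%:M : 'M[R]_n).
Proof. by split=> [|u u0]; rewrite ?trmx1// mulmx1 dotp_gt0. Qed.

(** With [p], [q] the squared norms of [u], [v] and [b] their inner product, the squared norm of
    [q u - b v] equals [q (p q - b^2)]. It is nonnegative and [q > 0]. *)
Lemma posdef_cauchy_schwarz D u v : posdef D ->
  dotp (u *m D) v ^+ 2 <= sqnormD D u * sqnormD D v.
Proof.
move=> Dp; have [DT Dp'] := Dp; have [->|v0] := eqVneq v 0.
  by rewrite dotp0r sqnormD0 mulr0 expr0n.
have := Dp' _ v0; rewrite -/(sqnormD D v) => v1.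
have := posdef_ge0 _ (sqnormD D v *: u - dotp (u *m D) v *: v) Dp.
rewrite sqnormDD // sqnormDN !sqnormDZ -scalemxAl !dotp_linear.
set b := dotp _ _; set p := sqnormD D u; set q := sqnormD D v => H.
rewrite -subr_ge0 -(pmulr_rge0 _ v1) -/q; apply: le_trans H _.
by rewrite -subr_ge0 le_eqVlt; apply/orP; left; apply/eqP; ring.
Qed.

Lemma cauchy_schwarz u v : dotp u v ^+ 2 <= dotp u u * dotp v v.
Proof.
have := posdef_cauchy_schwarz _ u v posdef1.
by rewrite mulmx1 !sqnormD_scalar !mul1r.
Qed.

(** Parallelogram law, with the term in [u - v] discarded. *)
Lemma sqnormDD_le D u v : posdef D ->
  sqnormD D (u + v) <= 2 * (sqnormD D u + sqnormD D v).
Proof.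
move=> Dp; have [DT _] := Dp; have := posdef_ge0 _ (u - v) Dp.
by rewrite !sqnormDD // sqnormDN dotpNr => H; lra.
Qed.

(** A nonzero vector of the kernel would have zero quadratic form. *)
Lemma posdef_unitmx D : posdef D -> D \in unitmx.
Proof.
move=> [_ Dp]; rewrite -row_free_unit -kermx_eq0; apply/eqP/row_matrixP => i.
rewrite row0; apply/eqP; apply: contraT => /Dp.
have /sub_kermxP -> := row_sub i (kermx D).
by rewrite dotp0r ltxx.
Qed.

Lemma enorm_ge0 u : 0 <= enorm u.
Proof. exact: sqrtr_ge0. Qed.

Lemma sqr_enorm u : enorm u ^+ 2 = dotp u u.
Proof. by rewrite sqr_sqrtr // dotp_ge0. Qed.

Lemma dotp_le_enorm u v : dotp u v <= enorm u * enorm v.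
Proof.
rewrite -sqrtrM ?dotp_ge0 //; apply: le_trans (ler_norm _) _.
by rewrite -sqrtr_sqr ler_wsqrtr // cauchy_schwarz.
Qed.

Lemma normr_coord_le_enorm u i : `|u 0 i| <= enorm u.
Proof.
rewrite -sqrtr_sqr ler_wsqrtr // /dotp (bigD1 i) //= expr2 lerDl.
by apply: sumr_ge0 => k _; rewrite -expr2 sqr_ge0.
Qed.

(** Carries Euclidean estimates over to the max norm, in which limits of vectors are taken. *)
Lemma normr_le_enorm u : `|u| <= enorm u.
Proof.
rewrite -[`|u|]/(mx_norm u) (mx_normrE u); apply: bigmax_le => [|[i j] _ /=].
  exact: enorm_ge0.
by rewrite ord1 normr_coord_le_enorm.
Qed.

End EuclideanTheory.

(** * First-order inequalities for convex functions and prox points *)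

Section ConvexTheory.
Context {R : realType} {n : nat}.
Implicit Types (u v w x y z : 'rV[R]_n) (D : 'M[R]_n).
Implicit Types (p f : 'rV[R]_n -> \bar R) (Y : set 'rV[R]_n).

Lemma proper_fin_num p u : (forall x, p x != -oo%E) -> edom p u ->
  p u \is a fin_num.
Proof. by move=> pN pu; rewrite fin_numE pN /= lt_eqF. Qed.

Lemma edom_fineK p u : (forall x, p x != -oo%E) -> edom p u ->
  (fine (p u))%:E = p u.
Proof. by move=> pN pu; rewrite fineK // proper_fin_num. Qed.

Lemma econvex_segment p x y (t : R) : econvex p -> (forall x, p x != -oo%E) ->
    edom p x -> edom p y -> 0 <= t <= 1 ->
  edom p (t *: x + (1 - t) *: y) /\
  fine (p (t *: x + (1 - t) *: y)) <= t * fine (p x) + (1 - t) * fine (p y).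
Proof.
move=> pc pN px py /andP[t0 t1]; have := pc x y t t0 t1.
rewrite -(edom_fineK _ _ pN px) -(edom_fineK _ _ pN py).
rewrite -!EFinM -EFinD => H.
have pt : edom p (t *: x + (1 - t) *: y) by apply: le_lt_trans H _; rewrite ltry.
by by split=> //; rewrite -lee_fin (edom_fineK _ _ pN pt).
Qed.

(** Divide by [s] and let [s] tend to 0; the chosen [s] makes [s * q] at most a given [e]. *)
Lemma le0_of_scaled_le_square (c q : R) :
  (forall s, 0 < s <= 1 -> s * c <= s ^+ 2 * q) -> c <= 0.
Proof.
move=> H; apply/ler_addgt0Pr => e e0; rewrite add0r.
have q0 : 0 < `|q| + 1 by rewrite ltr_wpDl.
pose s := Num.min 1 (e / (`|q| + 1)).
have s0 : 0 < s by rewrite lt_min ltr01 divr_gt0.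
have := H s; rewrite s0 ge_min lexx /= => /(_ isT).
rewrite expr2 -mulrA ler_pM2l // => /le_trans; apply.
apply: le_trans (_ : s * (`|q| + 1) <= _).
  by rewrite ler_pM2l //; apply: le_trans (ler_norm _) _; rewrite lerDl.
by rewrite -ler_pdivlMr // ge_min lexx orbT.
Qed.

(** First-order optimality without a sum rule for subdifferentials: [x] is compared with the point
    at parameter [s] on the segment towards [w]. Convexity leaves a term linear in [s] bounded by
    one quadratic in [s]. *)
Lemma prox_variational p D z x w : posdef D -> econvex p ->
    (forall u, p u != -oo%E) -> prox p D z x -> edom p w ->
  edom p x /\ fine (p x) + dotp ((z - x) *m D) (w - x) <= fine (p w).
Proof.
move=> Dp pc pN xmin pw; have [DT _] := Dp.
have px : edom p x.
  have := xmin w; rewrite -(edom_fineK _ _ pN pw) -EFinD.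
  rewrite /edom /=; case: (p x) => // r; first by rewrite ltry.
split=> //; rewrite -subr_le0.
apply: (@le0_of_scaled_le_square _ (2^-1 * sqnormD D (w - x))) => s /andP[s0 s1].
have s01 : 0 <= s <= 1 by rewrite ltW.
have [pus us] := econvex_segment p w x s pc pN pw px s01.
have := xmin (s *: w + (1 - s) *: x).
rewrite -(edom_fineK _ _ pN px) -(edom_fineK _ _ pN pus).
rewrite -!EFinD lee_fin.
have -> : s *: w + (1 - s) *: x - z = (x - z) + s *: (w - x).
  by apply/rowP => i; rewrite !mxE; ring.
rewrite (sqnormDD _ (x - z)) // sqnormDZ dotpZr -(opprB z x) mulNmx dotpNl => H.
set d := dotp _ _ in H *; nra.
Qed.

Lemma derive_grad f y v : differentiable (fine \o f) y ->
  'D_v (fine \o f) y = dotp (grad f y) v.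
Proof.
move=> df; rewrite deriveE // {1}(row_sum_delta v) linear_sum.
apply: eq_bigr => j _; rewrite linearZ /= mxE deriveE //.
by rewrite mulrC.
Qed.

(** By convexity each right difference quotient towards [u] is at most [f u - f y], and the bound
    passes to the directional derivative. *)
Lemma grad_inequality f u y : econvex f -> (forall x, f x != -oo%E) ->
    differentiable (fine \o f) y -> edom f y -> edom f u ->
  fine (f y) + dotp (grad f y) (u - y) <= fine (f u).
Proof.
move=> fc fN df fy fu; rewrite -lerBrDl -derive_grad //.
have dv : derivable (fine \o f) y (u - y) by exact: diff_derivable.
have cv : (fun h : R => h^-1 *: ((fine \o f) (h *: (u - y) + y) - fine (f y)))
   @ 0^'+ --> 'D_(u - y) (fine \o f) y.
  by apply: cvg_dnbhs_at_right; exact: dv.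
apply: (cvgr_to_le cv); near=> h.
have h0 : 0 < h by [].
have h01 : 0 <= h <= 1 by rewrite ltW //=; near: h; exact: nbhs_right_le.
have -> : h *: (u - y) + y = h *: u + (1 - h) *: y.
  by apply/rowP => i; rewrite !mxE; ring.
have [_ fs] := econvex_segment f u y h fc fN fu fy h01.
rewrite /= -[_ *: _]/(h^-1 * _) mulrC ler_pdivrMr //; lra.
Unshelve. all: by end_near. Qed.

End ConvexTheory.

(** * Limits of inner products and norms along a proper filter *)

Section Limits.
Context {R : realType} {n : nat} {T : Type} (U : set_system T).
Context {PU : ProperFilter U}.
Implicit Types (a b : 'rV[R]_n) (u v : T -> 'rV[R]_n).

Lemma cvg_coord u a i : u k @[k --> U] --> a -> u k 0 i @[k --> U] --> a 0 i.
Proof.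
by move=> ua; apply: (cvg_comp u (fun M : 'rV[R]_n => M 0 i) ua);
  exact: coord_continuous.
Qed.

Lemma cvg_dotp u v a b : u k @[k --> U] --> a -> v k @[k --> U] --> b ->
  dotp (u k) (v k) @[k --> U] --> dotp a b.
Proof.
move=> ua vb; apply: cvg_big => [|i _]; first exact: add_continuous.
by apply: cvgM; exact: cvg_coord.
Qed.

Lemma cvg_sqnormD (D : 'M[R]_n) u a : u k @[k --> U] --> a ->
  sqnormD D (u k) @[k --> U] --> sqnormD D a.
Proof.
move=> ua; apply: cvg_big => [|i _]; first exact: add_continuous.
apply: cvgM; first exact: cvg_coord.
rewrite mxE; under eq_fun do rewrite mxE.
apply: cvg_big => [|j _]; first exact: add_continuous.
by apply: cvgMr_tmp; exact: cvg_coord.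
Qed.

Lemma cvg_enorm u a : u k @[k --> U] --> a ->
  enorm (u k) @[k --> U] --> enorm a.
Proof.
move=> ua; have uu := cvg_dotp _ _ _ _ ua ua.
apply: (cvg_comp (fun k => dotp (u k) (u k)) Num.sqrt uu).
exact: sqrt_continuous.
Qed.

Lemma enorm_cvg0 u : enorm (u k) @[k --> U] --> (0 : R) ->
  u k @[k --> U] --> (0 : 'rV[R]_n).
Proof.
move=> u0; apply: norm_cvg0.
apply: (squeeze_cvgr _ (cvg_cst (0 : R)) u0).
by apply: nearW => k; rewrite normr_ge0 normr_le_enorm.
Qed.

Lemma sqnorm_cvg0 u : dotp (u k) (u k) @[k --> U] --> (0 : R) ->
  enorm (u k) @[k --> U] --> (0 : R).
Proof.
move=> u0; rewrite -(sqrtr0 R).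
apply: (cvg_comp (fun k => dotp (u k) (u k)) Num.sqrt u0).
exact: sqrt_continuous.
Qed.

Lemma cvgB0P u a : u k - a @[k --> U] --> (0 : 'rV[R]_n) -> u k @[k --> U] --> a.
Proof.
move=> ua; rewrite -(add0r a) [u in u k @[k --> _]](_ : _ = fun k => u k - a + a).
  by apply: cvgD => //; exact: cvg_cst.
by apply/funext => k; rewrite subrK.
Qed.

End Limits.

(** * Local bounds and subgradients of a finite convex function *)

Section FiniteConvex.
Context {R : realType} {n : nat} (h : 'rV[R]_n -> R).
Implicit Types (c d x y v : 'rV[R]_n).
Hypothesis hconvex : convex_function [set: 'rV[R]_n] h.

Lemma convex_le x y (t : R) : 0 <= t -> t <= 1 ->
  h (t *: x + (1 - t) *: y) <= t * h x + (1 - t) * h y.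
Proof.
by move=> t0 t1; have := hconvex (Itv01 t0 t1) x y; rewrite !inE; apply.
Qed.

(* A point of a k-dimensional face of the cube is a convex combination of points
   of two opposite (k-1)-dimensional faces. *)
Lemma convex_bounded_above c : exists M, forall d, `|d| <= 1 -> h (c + d) <= M.
Proof.
have H k : (k <= n)%N -> forall c, exists M, forall d,
    (forall i, `|d 0 i| <= 1) -> (forall i : 'I_n, (k <= i)%N -> d 0 i = 0) ->
    h (c + d) <= M.
  elim: k => [_ c'|k IH kn c'].
    exists (h c') => d _ d0; rewrite (_ : d = 0) ?addr0 //.
    by apply/rowP => i; rewrite d0 // mxE.
  pose i0 := Ordinal kn; pose e : 'rV[R]_n := delta_mx 0 i0.
  have [M1 H1] := IH (ltnW kn) (c' + e).
  have [M2 H2] := IH (ltnW kn) (c' - e).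
  exists (Num.max M1 M2) => d d1 d0.
  pose d' := d - d 0 i0 *: e.
  have d'E i : d' 0 i = if i == i0 then 0 else d 0 i.
    rewrite !mxE eqxx /=; case: eqVneq => [->|_]; first by rewrite mulr1 subrr.
    by rewrite mulr0 subr0.
  have d'1 i : `|d' 0 i| <= 1 by rewrite d'E; case: ifP => _; rewrite ?normr0.
  have d'0 (i : 'I_n) : (k <= i)%N -> d' 0 i = 0.
    rewrite d'E; case: eqVneq => // ii0; rewrite leq_eqVlt => /orP[/eqP ki|/d0//].
    by case/eqP: ii0; apply: val_inj.
  have := d1 i0; rewrite ler_norml => /andP[t1 t2].
  set t := d 0 i0 in d' d'E d'1 d'0 t1 t2 *.
  have -> : c' + d = ((1 + t) / 2) *: (c' + e + d')
                   + (1 - (1 + t) / 2) *: (c' - e + d').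
    by apply/rowP => i; rewrite !mxE; field.
  apply: le_trans (convex_le _ _ _ _ _) _; [lra|lra|].
  have := H1 _ d'1 d'0; have := H2 _ d'1 d'0.
  have : M1 <= Num.max M1 M2 by rewrite le_max lexx.
  have : M2 <= Num.max M1 M2 by rewrite le_max lexx orbT.
  nra.
have [M HM] := H n (leqnn n) c; exists M => d d1; apply: HM => i.
  apply: le_trans d1; rewrite -[`|d|]/(mx_norm d) mx_normrE.
  by apply: (le_bigmax _ (fun ij => `|d ij.1 ij.2|) (0, i)).
by rewrite leqNgt ltn_ord.
Qed.

(** The center [c] lies between [x] and the point [c + d] of the unit sphere opposite to it, with
    weights [1 / (1 + l)] and [l / (1 + l)]; solve the convexity inequality for [h x]. *)
Lemma convex_lower_bound c M x : (forall d, `|d| <= 1 -> h (c + d) <= M) ->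
  `|x - c| <= 1 -> h c - `|x - c| * (M - h c) <= h x.
Proof.
move=> HM; have [->|xc] := eqVneq x c; first by rewrite subrr normr0 mul0r subr0.
set l := `|x - c| => l1; have l0 : 0 < l by rewrite normr_gt0 subr_eq0.
pose d := - (l^-1 *: (x - c)).
have : h (c + d) <= M.
  by apply: HM; rewrite normrN normrZ normfV normr_id mulVf ?lt0r_neq0.
have l2 : 1 + l != 0 by rewrite lt0r_neq0 // addr_gt0.
have := convex_le x (c + d) (1 + l)^-1.
have -> : (1 + l)^-1 *: x + (1 - (1 + l)^-1) *: (c + d) = c.
  apply/rowP => i; rewrite !mxE; field.
  by rewrite (gt_eqF l0).
have i0 : 0 <= (1 + l)^-1 by rewrite invr_ge0 addr_ge0 // ltW.
have i1 : (1 + l)^-1 <= 1 by rewrite invf_le1 ?addr_gt0 // lerDl ltW.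
move=> /(_ i0 i1) H1 H2.
have : (1 + l) * h c <= h x + l * h (c + d).
  rewrite -ler_pdivlMl ?addr_gt0 //; apply: le_trans H1 _.
  by rewrite le_eqVlt; apply/orP; left; apply/eqP; field.
nra.
Qed.

Lemma subdiff_le x y v : subdiff (EFin \o h) x v -> h x + dotp v (y - x) <= h y.
Proof. by case=> _ /(_ y); rewrite /= -EFinD lee_fin. Qed.

(** Each coordinate of [v] is bounded by testing the subgradient inequality at distance at most 1/2
    from [x], a point still in the unit ball around [c]. *)
Lemma subdiff_bounded c : exists B, forall x v,
  `|x - c| <= 2^-1 -> subdiff (EFin \o h) x v -> `|v| <= B.
Proof.
have [M HM] := convex_bounded_above c.
(* The upper bound [M] at [x + e] and the lower bound at [x] give [3 (M - h c)]; 4 leaves room. *)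
exists (4 * (M - h c)) => x v xc xv.
have Mc : h c <= M by have := HM 0; rewrite normr0 addr0; apply.
rewrite -[`|v|]/(mx_norm v) mx_normrE; apply: bigmax_le => [|[i j] _ /=].
  by rewrite mulr_ge0 // subr_ge0.
rewrite (ord1 i) {i}.
(* The sign makes the inner product of [v] and [e] equal to half of the absolute value of
   [v 0 j]. *)
pose e : 'rV[R]_n := (2^-1 * Num.sg (v 0 j)) *: delta_mx 0 j.
have /(_ (x + e)) := @subdiff_le x _ v xv.
rewrite [x + e - x]addrAC subrr add0r dotpZr.
have -> : dotp v (delta_mx 0 j) = v 0 j.
  rewrite /dotp (bigD1 j) //= big1 => [|i ij]; rewrite mxE eqxx /=.
    by rewrite eqxx mulr1 addr0.
  by rewrite (negbTE ij) mulr0.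
rewrite -mulrA -normrEsg.
have e1 : `|e| <= 2^-1.
  rewrite -[`|e|]/(mx_norm e) mx_normrE; apply: bigmax_le => [|[i k] _ /=].
    lra.
  rewrite !mxE !normrM normr_sg.
  rewrite ger0_norm ?invr_ge0 // -[leRHS]mulr1 -mulrA ler_pM2l ?invr_gt0 //.
  by case: (v 0 j != 0); case: (_ && _) => /=; rewrite ?normr0 ?normr1 ?mulr0 ?mul0r ?mulr1.
have : h (x + e) <= M.
  rewrite (_ : x + e = c + (x - c + e)); last by rewrite addrA subrKC.
  apply: HM; apply: le_trans (ler_normD _ _) _; lra.
have := convex_lower_bound c M x HM.
have : 0 <= `|x - c| by [].
nra.
Qed.

(** The graph of the subdifferential is closed. [convex_lower_bound] supplies lower semicontinuity
    of [h] at [c], which suffices to pass to the limit. *)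
Lemma subdiff_cvg {T : Type} (U : set_system T) {PU : ProperFilter U}
    (x v : T -> 'rV[R]_n) c w :
  (\forall k \near U, subdiff (EFin \o h) (x k) (v k)) ->
  x k @[k --> U] --> c -> v k @[k --> U] --> w -> subdiff (EFin \o h) c w.
Proof.
move=> sub xc vw; split=> [|y /=]; first by rewrite /edom /= ltry.
rewrite -EFinD lee_fin.
have [M HM] := convex_bounded_above c.
have xc0 : `|x k - c| @[k --> U] --> (0 : R).
  rewrite -(normr0 'rV[R]_n) -(subrr c).
  by apply: cvg_norm; apply: cvgB => //; exact: cvg_cst.
have lim : h c - `|x k - c| * (M - h c) + dotp (v k) (y - x k)
    @[k --> U] --> h c - 0 * (M - h c) + dotp w (y - c).
  apply: cvgD; last by apply: cvg_dotp => //; apply: cvgB => //; exact: cvg_cst.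
  by apply: cvgB; [exact: cvg_cst | apply: cvgMr_tmp].
rewrite mul0r subr0 in lim; apply: (cvgr_to_le lim); near=> k.
apply: le_trans (@subdiff_le (x k) _ (v k) _); last by near: k.
rewrite lerD2r convex_lower_bound //.
by near: k; apply: (cvgr_le _ xc0); exact: ltr01.
Unshelve. all: by end_near. Qed.

End FiniteConvex.

(** * Real sequences: descent, summable perturbations and the momentum recursion *)

Section RealSequences.
Context {R : realType}.
Implicit Types (u a F L : nat -> R).

Lemma cvg_increments_bounded_monotone u (S : R) :
  (forall k, u k <= u k.+1) -> (forall k, u k <= S) ->
  u k.+1 - u k @[k --> \oo] --> (0 : R).
Proof.
move=> /nondecreasing_seqP um uS.
have cu : cvgn u by apply: nondecreasing_is_cvgn => //; exists S => _ [k _ <-].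
rewrite -(subrr (limn u)); apply: cvgB => //.
by have := cu; rewrite -[X in X -> _]/(u @ \oo --> limn u) -cvg_shiftS.
Qed.

Lemma summable_partial_sums_bounded u :
  (forall k, (0 < k)%N -> 0 <= u k) ->
  (\sum_(1 <= k <oo) (u k)%:E < +oo)%E ->
  exists S, forall N, \sum_(1 <= k < N) u k <= S.
Proof.
move=> u0 us; exists (fine (\sum_(1 <= k <oo) (u k)%:E)%E) => N.
have sN M : (\sum_(1 <= k < M) (u k)%:E <= \sum_(1 <= k <oo) (u k)%:E)%E.
  by apply: nneseries_lim_ge => k k1 _; rewrite lee_fin u0.
rewrite -lee_fin fineK -?sumEFin //; rewrite fin_numE; apply/andP; split.
  by apply/eqP => E; have := sN 0%N; rewrite E big_geq.
by rewrite lt_eqF.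
Qed.

Lemma summable_cvg0 u (S : R) :
  (forall k, (0 < k)%N -> 0 <= u k) ->
  (forall N, \sum_(1 <= k < N) u k <= S) -> u k @[k --> \oo] --> (0 : R).
Proof.
move=> u0 uS; rewrite -cvg_shiftS.
pose s k := \sum_(1 <= i < k.+1) u i.
have sE k : s k.+1 = s k + u k.+1 by rewrite /s big_nat_recr.
have -> : [sequence u k.+1]_k = (fun k => s k.+1 - s k).
  by apply/funext => k; rewrite sE addrC addKr.
apply: (@cvg_increments_bounded_monotone s S) => k; last exact: uS.
by rewrite sE lerDl u0.
Qed.

(** The energy [E = F + c a] drops by at least [(1 - c) a] at each step and is bounded below. Hence
    [E] converges, its decrements force [a] to 0, and [F = E - c a] converges. *)
Lemma descent_cvg F a (c Fs : R) : 0 <= c < 1 ->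
  (exists K, forall k, (K <= k)%N ->
     [/\ 0 <= a k, Fs <= F k & F k.+1 + a k.+1 <= F k + c * a k]) ->
  (exists l : R, F k @[k --> \oo] --> l) /\ a k @[k --> \oo] --> (0 : R).
Proof.
move=> /andP[c0 c1] [K HK].
pose E k := F (k + K)%N + c * a (k + K)%N.
have HE k : E k.+1 + (1 - c) * a (k.+1 + K)%N <= E k.
  have [_ _] := HK _ (leq_addl k K); rewrite /E addSn; lra.
have a0 k : 0 <= a (k + K)%N by have [] := HK _ (leq_addl k K).
have Em k : E k.+1 <= E k.
  apply: le_trans (HE k); rewrite lerDl mulr_ge0 //; lra.
have Eb k : Fs <= E k.
  have [_ F0 _] := HK _ (leq_addl k K).
  by rewrite /E -[Fs]addr0 lerD // mulr_ge0.
have cE : cvgn E.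
  apply: nonincreasing_is_cvgn; first exact/nonincreasing_seqP.
  by exists Fs => _ [k _ <-].
have dE : E k - E k.+1 @[k --> \oo] --> (0 : R).
  rewrite -(subrr (limn E)); apply: cvgB => //.
  by have := cE; rewrite -[X in X -> _]/(E @ \oo --> limn E) -cvg_shiftS.
have aS : a (k.+1 + K)%N @[k --> \oo] --> (0 : R).
  have c2 : 0 < 1 - c by lra.
  have lim : (E k - E k.+1) / (1 - c) @[k --> \oo] --> (0 : R).
    by rewrite -(mul0r (1 - c)^-1); apply: cvgMr_tmp.
  apply: (squeeze_cvgr _ (cvg_cst (0 : R)) lim); apply: nearW => k.
  rewrite a0 ler_pdivlMr //= ; have := HE k; lra.
have aK : a (k + K)%N @[k --> \oo] --> (0 : R) by rewrite -cvg_shiftS.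
split; last by rewrite -(cvg_shiftn K).
exists (limn E - c * 0); rewrite -(cvg_shiftn K).
have -> : [sequence F (k + K)%N]_k = (fun k => E k - c * a (k + K)%N).
  by apply/funext => k; rewrite /E /= addrK.
by apply: cvgB => //; apply: cvgMl_tmp.
Qed.

(** A genuine jump raises [L] by at least [(eta - 1) * Lmin], while the increments of a bounded
    monotone sequence tend to 0. *)
Lemma geometric_jumps_eventually_constant L (e : nat -> nat) (eta Lmin Lmax : R) :
  1 < eta -> 0 < Lmin -> (forall k, Lmin <= L k <= Lmax) ->
  (forall k, L k.+1 = eta ^+ e k * L k) ->
  exists K, forall k, (K <= k)%N -> L k.+1 = L k.
Proof.
move=> eta1 Lmin0 Lb Le.
have eta0 : 0 < eta by lra.
have L0 k : 0 < L k by apply: lt_le_trans Lmin0 _; have /andP[] := Lb k.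
have jump k : (0 < e k)%N -> (eta - 1) * Lmin <= L k.+1 - L k.
  move=> ek; have /andP[Lk _] := Lb k.
  have : eta <= eta ^+ e k by rewrite -{1}[eta]expr1 ler_weXn2l // ltW.
  rewrite Le; have := L0 k; nra.
have Lm k : L k <= L k.+1.
  by rewrite Le ler_peMl ?exprn_ege1 // ltW.
have := cvg_increments_bounded_monotone L Lmax Lm.
have LM k : L k <= Lmax by have /andP[] := Lb k.
move=> /(_ LM) dL.
have pos : 0 < (eta - 1) * Lmin by rewrite mulr_gt0 // subr_gt0.
have [K _ HK] := cvgr_lt _ dL _ pos; exists K => k /HK /= dk.
rewrite Le; case: (posnP (e k)) => [->|/jump jk]; first by rewrite mul1r.
by rewrite ltNge jk in dk.
Qed.

Lemma exp_bounded_products (u p : nat -> R) (S : R) :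
  (forall k, (0 < k)%N -> 0 <= u k) -> (forall N, \sum_(1 <= k < N) u k <= S) ->
  (forall k, (0 < k)%N -> 0 <= p k) ->
  (forall k, (0 < k)%N -> p k.+1 <= (1 + u k) * p k) ->
  forall k, (0 < k)%N -> p k <= expR S * p 1%N.
Proof.
move=> u0 uS p0 pu k k0.
(* The induction needs the partial sum in the exponent; each factor is absorbed through
   [1 + u <= expR u]. *)
apply: (le_trans (y := expR (\sum_(1 <= i < k) u i) * p 1%N)); last first.
  by rewrite ler_wpM2r ?p0 // ler_expR.
elim: k k0 => // -[_ _|k IH _]; first by rewrite big_geq // expR0 mul1r.
apply: le_trans (pu _ _) _ => //.
rewrite big_nat_recr //= expRD mulrAC mulrC.
apply: ler_pM; [exact: p0 | by rewrite addr_ge0 ?u0 | exact: IH | exact: expR_ge1Dx].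
Qed.

(** The larger root of [t^2 = t + q]. *)
Definition momentum_root (q : R) : R := (1 + Num.sqrt (1 + 4 * q)) / 2.

Lemma momentum_rootP (q : R) : 0 <= q ->
  1 <= momentum_root q /\ momentum_root q ^+ 2 = momentum_root q + q.
Proof.
move=> q0; have q1 : 0 <= 1 + 4 * q by lra.
have s1 : 1 <= Num.sqrt (1 + 4 * q).
  by rewrite -[X in X <= _]sqrtr1 ler_wsqrtr //; lra.
have := sqr_sqrtr q1; rewrite /momentum_root.
set s := Num.sqrt _ in s1 *; split; [lra | nra].
Qed.

(** For [t > 1 + s] the product [t (t - 1)] would exceed [s^2], hence [q]. *)
Lemma momentum_root_le (q s : R) : 0 <= q -> 0 <= s -> q <= s ^+ 2 ->
  momentum_root q <= 1 + s.
Proof. by move=> q0 s0 qs; have [] := momentum_rootP q q0; nra. Qed.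

(** One formula for both recursions: the monotone rule has no stepsize ratio, so it fits only when
    that ratio is 1. *)
Lemma theta_next_root bt (th Lp L : R) :
  (exists T1 rho, bt = NonMonotone T1 rho) \/ L = Lp -> Lp != 0 ->
  theta_next bt th Lp L = momentum_root (th ^+ 2 * (L / Lp)).
Proof.
move=> + Lp0; case: bt => [T1 rho _|[[? []//]|->]] /=.
  by rewrite /momentum_root !mulrA.
by rewrite /momentum_root divff // mulr1.
Qed.

Lemma theta_next_monotone (th Lp L : R) :
  theta_next Monotone th Lp L = momentum_root (th ^+ 2).
Proof. by []. Qed.

(** The new momentum [e] satisfies [e^2 = e + th^2 L / Lp], so [L / e^2 <= Lp / th^2]; the factor
    [th^2] cancels against the bound on [m (th - 1)]. *)
Lemma momentum_sqr_le (th Lp L m kappa : R) : 1 <= th -> 0 < Lp -> 0 < L ->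
  0 <= m -> m * (th - 1) <= kappa * th ->
  L * (m * ((th - 1) / momentum_root (th ^+ 2 * (L / Lp)))) ^+ 2
    <= kappa ^+ 2 * Lp.
Proof.
move=> th1 Lp0 L0 m0 mk.
have q0 : 0 <= th ^+ 2 * (L / Lp).
  by rewrite mulr_ge0 ?sqr_ge0 // divr_ge0 // ltW.
have [] := momentum_rootP _ q0; set e := momentum_root _ => e1 e2.
have e0 : 0 < e by lra.
have eL : th ^+ 2 * L <= Lp * e ^+ 2.
  rewrite e2 mulrDr [Lp * (_ * _)]mulrCA [Lp * (L / Lp)]mulrC divfK ?gt_eqF // lerDr mulr_ge0 //; lra.
have mk2 : (m * (th - 1)) ^+ 2 <= (kappa * th) ^+ 2.
  have m1 : 0 <= m * (th - 1) by rewrite mulr_ge0 // subr_ge0.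
  by rewrite ler_pXn2r // nnegrE //; apply: le_trans mk.
rewrite [m * (_ / _)]mulrA expr_div_n mulrA ler_pdivrMr ?exprn_gt0 //.
apply: le_trans (_ : L * (kappa * th) ^+ 2 <= _); first by rewrite ler_pM2l.
have : kappa ^+ 2 * (th ^+ 2 * L) <= kappa ^+ 2 * (Lp * e ^+ 2).
  by rewrite ler_wpM2l // sqr_ge0.
by rewrite exprMn; lra.
Qed.

End RealSequences.

(** * Indicator functions and weighted projections *)

Section Projection.
Context {R : realType} {n : nat} (Y : set 'rV[R]_n).
Context (Yconvex : convex_set (Y : set (convex_lmodType 'rV[R]_n))).

Lemma convex_set_segment x y (t : R) : Y x -> Y y -> 0 <= t -> t <= 1 ->
  Y (t *: x + (1 - t) *: y).
Proof.
move=> Yx Yy t0 t1; have := Yconvex x y (Itv01 t0 t1).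
by rewrite !inE; apply.
Qed.

Lemma indicatorE x : Y x -> indicator Y x = 0%E.
Proof. by move=> Yx; rewrite /indicator mem_set. Qed.

Lemma edom_indicator x : edom (indicator Y) x <-> Y x.
Proof.
rewrite /edom /= /indicator; split=> [|Yx]; last by rewrite mem_set // ltry.
by case: ifPn => [/set_mem//|_]; rewrite ltxx.
Qed.

Lemma indicator_ninfty x : indicator Y x != -oo%E.
Proof. by rewrite /indicator; case: ifP. Qed.

Lemma indicator_ge0 x : (0 <= indicator Y x)%E.
Proof. by rewrite /indicator; case: ifP. Qed.

Lemma econvex_indicator : econvex (indicator Y).
Proof.
move=> x y t t0 t1.
have s0 : 0 <= 1 - t by rewrite subr_ge0.
have pos : (0 <= t%:E * indicator Y x + (1 - t)%:E * indicator Y y)%E.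
  by rewrite adde_ge0 // mule_ge0 ?lee_fin ?indicator_ge0.
(* The endpoint weights are separate because [0 * +oo] is 0; for interior weights a point outside
   [Y] makes the right-hand side infinite. *)
have [->|t_neq0] := eqVneq t 0.
  by rewrite mul0e add0e subr0 mul1e scale0r add0r scale1r.
have [->|t_neq1] := eqVneq t 1.
  by rewrite subrr mul0e adde0 mul1e scale0r addr0 scale1r.
have t_gt0 : 0 < t by rewrite lt0r t_neq0.
have s_gt0 : 0 < 1 - t by rewrite subr_gt0 lt_neqAle t_neq1.
have [Yx|nYx] := pselect (Y x); last first.
  rewrite {2}/indicator memNset // mulry gtr0_sg // mul1e addye ?leey //.
  rewrite -ltNye; apply: lt_le_trans (ltNy0) _.
  by rewrite mule_ge0 ?lee_fin ?indicator_ge0.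
have [Yy|nYy] := pselect (Y y); last first.
  rewrite {3}/indicator memNset // mulry gtr0_sg // mul1e addey ?leey //.
  by rewrite indicatorE // mule0.
by rewrite indicatorE //; exact: convex_set_segment.
Qed.

(** The variational inequality makes the inner product of [z - y] and [y - w] nonnegative; expand
    the square of their sum [z - w]. *)
Lemma projD_le (D : 'M[R]_n) z y w : posdef D -> projD Y D z y -> Y w ->
  Y y /\ sqnormD D (y - w) <= sqnormD D (z - w).
Proof.
move=> Dp yproj Yw.
have [|/edom_indicator Yy] :=
  prox_variational _ _ _ _ w Dp econvex_indicator indicator_ninfty yproj.
  exact/edom_indicator.
rewrite !indicatorE //= add0r => H; split=> //.
rewrite (_ : z - w = (z - y) + (y - w)); last by rewrite addrA subrK.
have [DT _] := Dp; have := posdef_ge0 _ (z - y) Dp.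
by move: H; rewrite (sqnormDD _ (z - y)) // -(opprB y w) dotpNr; lra.
Qed.

End Projection.

(** * Positive multiples of extended-valued functions *)

Section ScaledFunction.
Context {R : realType} {n : nat} (p : 'rV[R]_n -> \bar R) (t : R).
Context (pN : forall x, p x != -oo%E) (t0 : 0 < t).

Lemma mule_ninfty (s : R) x : 0 <= s -> (s%:E * p x)%E != -oo%E.
Proof.
have := pN x; case: (p x) => // _; rewrite le_eqVlt => /orP[/eqP<-|s0].
  by rewrite mul0e.
by rewrite mulry gtr0_sg // mul1e.
Qed.

Lemma edom_scaled x : edom (fun u => t%:E * p u)%E x <-> edom p x.
Proof.
rewrite /edom /=; have := pN x; case: (p x) => // [r|] _; first by rewrite !ltry.
by rewrite mulry gtr0_sg // mul1e.
Qed.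

Lemma econvex_scaled : econvex p -> econvex (fun u => t%:E * p u)%E.
Proof.
move=> pc x y s s0 s1.
have s2 : 0 <= 1 - s by rewrite subr_ge0.
rewrite muleCA (muleCA (1 - s)%:E) -muleDr //.
  by rewrite lee_pmul2l ?lte_fin //; exact: pc.
by apply: ltninfty_adde_def; rewrite inE ltNye mule_ninfty.
Qed.

End ScaledFunction.

(** * One trial: optimality, descent and rejection *)

Section Step.
Context {R : realType} {n : nat}.
Context (f g : 'rV[R]_n -> \bar R) (h : 'rV[R]_n -> R) (Y : set 'rV[R]_n).
Context (Lf : R).
Context (fproper : eproper f) (fconvex : econvex f).
Context (gproper : eproper g) (gconvex : econvex g).
Context (Yconvex : convex_set (Y : set (convex_lmodType 'rV[R]_n))).
Context (gY : edom g `<=` Y) (Yf : Y `<=` interior (edom f)).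
Context (fsmooth : smooth_on f Lf Y).

Let fN x : f x != -oo%E. Proof. by case: fproper => /(_ x). Qed.
Let gN x : g x != -oo%E. Proof. by case: gproper => /(_ x). Qed.
Let fY x : Y x -> edom f x. Proof. by move=> /Yf; exact: interior_subset. Qed.

Local Set Implicit Arguments.
Local Unset Strict Implicit.

(** Faithful only on the domain of [g], since [fine] sends infinite values to 0. *)
Definition real_objective x : R := fine (f x) + fine (g x) - h x.

Lemma objectiveE x : edom g x -> objective f g h x = (real_objective x)%:E.
Proof.
move=> gx; rewrite /objective -(edom_fineK _ _ fN (fY _ (gY _ gx))).
by rewrite -(edom_fineK _ _ gN gx).
Qed.

Lemma grad_inequality_on u y : Y u -> Y y ->
  fine (f y) + dotp (grad f y) (u - y) <= fine (f u).
Proof.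
by move=> Yu Yy; apply: grad_inequality => //; [case: fsmooth => + _; exact|..];
  exact: fY.
Qed.

Context {eta Linit : R} {xp xpp hs : 'rV[R]_n} {i : nat} {T : trial R n}.
Context (step : trial_step f g Y eta Linit xp xpp hs i T).
Context (L_gt0 : 0 < tL T) (Yxp : Y xp).
Let Dp : posdef (tD T). Proof. by case: step. Qed.

Lemma step_y_in : Y (ty T).
Proof. by case: step => _ _ _ yproj _; have [] := projD_le _ Yconvex _ _ _ _ Dp yproj Yxp. Qed.

Lemma step_y_dist :
  sqnormD (tD T) (ty T - xp) <= tbeta T ^+ 2 * sqnormD (tD T) (xp - xpp).
Proof.
case: step => _ _ _ yproj _.
have [_] := projD_le _ Yconvex _ _ _ _ Dp yproj Yxp.
by rewrite (addrC xp (_ *: _)) addrK sqnormDZ.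
Qed.

(** In the variational inequality of the prox, multiplying by [tD T] cancels its inverse in the prox
    center; dividing by the stepsize then exhibits a subgradient of [g] at [tx T]. *)
Lemma step_prox w : edom g w -> edom g (tx T) /\
  fine (g (tx T)) + dotp (tL T *: ((ty T - tx T) *m tD T)
     - (grad f (ty T) - hs)) (w - tx T) <= fine (g w).
Proof.
move=> gw; case: step => _ _ _ _ xprox.
have t0 : 0 < 1 / tL T by rewrite divr_gt0.
have [||gx] := prox_variational _ _ _ _ w Dp (econvex_scaled _ _ gN t0 gconvex) _ xprox.
- by move=> u; apply: mule_ninfty => //; exact: ltW.
- exact/(edom_scaled _ _ gN t0).
have {}gx : edom g (tx T) by apply/(edom_scaled _ _ gN t0).
rewrite -(edom_fineK _ _ gN gx) -(edom_fineK _ _ gN gw) -!EFinM /=.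
rewrite addrAC mulmxBl -scalemxAl mulmxKV ?posdef_unitmx // => H; split=> //.
rewrite -(ler_pM2l t0) mulrDr; apply: le_trans H.
rewrite -dotpZl scalerBr scalerA mul1r mulVf ?gt_eqF // scale1r.
by rewrite le_refl.
Qed.

Lemma step_x_in : edom g (tx T).
Proof. by case: gproper => _ [w gw]; have [] := step_prox gw. Qed.

Let Yx : Y (tx T). Proof. exact/gY/step_x_in. Qed.

Lemma accepts_le : accepts f T <->
  fine (f (tx T)) <= fine (f (ty T)) + dotp (grad f (ty T)) (tx T - ty T)
     + tL T / 2 * sqnormD (tD T) (tx T - ty T).
Proof.
rewrite /accepts -(edom_fineK _ _ fN (fY _ Yx)) -(edom_fineK _ _ fN (fY _ step_y_in)).
rewrite -EFinD lee_fin addrA.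
by rewrite (_ : 1 / (2 * (1 / tL T)) = tL T / 2) //; field; rewrite gt_eqF.
Qed.

Lemma step_descent : accepts f T -> subdiff (EFin \o h) xp hs -> edom g xp ->
  real_objective (tx T) + tL T / 2 * sqnormD (tD T) (tx T - xp)
    <= real_objective xp
       + tL T / 2 * (tbeta T ^+ 2 * sqnormD (tD T) (xp - xpp)).
Proof.
move=> /accepts_le acc hsub gxp.
have gr := grad_inequality_on Yxp step_y_in.
have [_ pr] := step_prox gxp.
have hx : h xp + dotp hs (tx T - xp) <= h (tx T).
  by case: hsub => _ /(_ (tx T)); rewrite /= -EFinD lee_fin.
have yd : tL T / 2 * sqnormD (tD T) (ty T - xp) <=
     tL T / 2 * (tbeta T ^+ 2 * sqnormD (tD T) (xp - xpp)).
  by rewrite ler_pM2l ?divr_gt0 //; exact: step_y_dist.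
rewrite /real_objective; move: acc gr pr hx yd; have [DT _] := Dp.
set x := tx T; set y := ty T; set D := tD T; set L := tL T.
(* In terms of [p = xp - x] and [q = x - y], the cross term from the prox inequality completes the
   square of [p + q = xp - y]; all the rest is linear. *)
have -> : xp - y = (xp - x) + (x - y) by rewrite addrA subrK.
have -> : y - xp = - ((x - y) + (xp - x)).
  by apply/rowP => j; rewrite !mxE; ring.
rewrite -(opprB xp x) -(opprB x y).
move: (xp - x) (x - y) => p q.
rewrite !sqnormDN (sqnormDD _ q) // !(mulNmx, dotp_linear).
lra.
Qed.

(* The gradient inequalities at both points stand in for the descent lemma: they
   lose only a factor 2 in the constant. *)
Lemma step_reject (mu : R) : loewner mu%:M (tD T) -> 0 < mu ->
  ~ accepts f T -> tL T * mu < 2 * Lf.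
Proof.
move=> muD mu0 /accepts_le/negP; rewrite -ltNge => rej.
have gr := grad_inequality_on step_y_in Yx.
have := loewner_sqnormD _ _ (tx T - ty T) muD; rewrite sqnormD_scalar => mD.
have [_ /(_ _ _ Yx step_y_in) lip] := fsmooth.
have cs : dotp (grad f (tx T) - grad f (ty T)) (tx T - ty T)
    <= Lf * dotp (tx T - ty T) (tx T - ty T).
  apply: le_trans (dotp_le_enorm _ _) _.
  by rewrite -sqr_enorm expr2 mulrA ler_wpM2r ?enorm_ge0.
move: rej gr cs; rewrite -(opprB (tx T) (ty T)) dotpDl !dotpNl !dotpNr.
move=> rej gr cs.
have := dotp_ge0 (tx T - ty T).
have : tL T / 2 * (mu * dotp (tx T - ty T) (tx T - ty T))
    <= tL T / 2 * sqnormD (tD T) (tx T - ty T).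
  by rewrite ler_pM2l // divr_gt0.
nra.
Qed.

End Step.

(** * Invariants of a run and bounds on stepsizes and metrics *)

Section Run.
Context {R : realType} {n : nat}.
Context (f g : 'rV[R]_n -> \bar R) (h : 'rV[R]_n -> R) (Y : set 'rV[R]_n).
Context (Lf : R).
Context (fproper : eproper f) (fconvex : econvex f).
Context (gproper : eproper g) (gconvex : econvex g).
Context (Yconvex : convex_set (Y : set (convex_lmodType 'rV[R]_n))).
Context (gY : edom g `<=` Y) (Yf : Y `<=` interior (edom f)).
Context (fsmooth : smooth_on f Lf Y).
Context (eta Lmin : R) (eta_gt1 : 1 < eta) (Lmin_gt0 : 0 < Lmin).
Context (bt : backtracking R) (em : extrapolation R).
Context (bt_params : backtracking_params bt) (em_params : extrapolation_params em).
Context (Linit : nat -> R) (hs : nat -> 'rV[R]_n).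
Context (tr : nat -> nat -> trial R n) (acc : nat -> nat) (x : nat -> 'rV[R]_n).
Context (run : spdcae f g h Y eta Lmin Linit hs tr acc x).
Context (Lrule : Linit_rule bt Lmin Linit tr acc).
Context (brule : beta_rule bt em tr acc x).
Context (mu : R) (mu_gt0 : 0 < mu) (etas : nat -> R).
Context (etas_ge0 : forall k, (0 < k)%N -> 0 <= etas k).
Context (S : R) (etas_sum : forall N, \sum_(1 <= k < N) etas k <= S).
Context (scaling : scaling_condition mu etas tr acc).

Local Set Implicit Arguments.
Local Unset Strict Implicit.

Let A k := tr k (acc k).
Let L k := tL (A k).
Let th k := ttheta (A k).
Let Q k u := sqnormD (tD (A k)) u.
Let F k := real_objective f g h (x k).
Let a k := L k / 2 * Q k (x k - x k.-1).

Let eta0 : 0 < eta. Proof. exact: lt_trans eta_gt1. Qed.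

Lemma run_step k i : (0 < k)%N -> (i <= acc k)%N ->
  trial_step f g Y eta (Linit k) (x k.-1) (x k.-2) (hs k.-1) i (tr k i).
Proof. by move=> k0 ik; have [_ /(_ k k0)[_ _ + _ _]] := run; apply. Qed.

Lemma run_accepts k : (0 < k)%N -> accepts f (A k).
Proof. by move=> k0; have [_ /(_ k k0)[_ _ _ _ []]] := run. Qed.

Lemma run_rejects k i : (0 < k)%N -> (i < acc k)%N -> ~ accepts f (tr k i).
Proof. by move=> k0 ik; have [_ /(_ k k0)[_ _ _ + _]] := run; apply. Qed.

Lemma run_x k : (0 < k)%N -> x k = tx (A k).
Proof. by move=> k0; have [_ /(_ k k0)[_ _ _ _ []]] := run. Qed.

Lemma run_subdiff k : (0 < k)%N -> subdiff (EFin \o h) (x k.-1) (hs k.-1).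
Proof. by move=> k0; have [_ /(_ k k0)[]] := run. Qed.

Lemma run_Linit_ge k : (0 < k)%N -> Lmin <= Linit k.
Proof. by move=> k0; have [_ /(_ k k0)[]] := run. Qed.

Lemma run_L k i : (0 < k)%N -> (i <= acc k)%N ->
  tL (tr k i) = eta ^+ i * Linit k.
Proof. by move=> k0 /(run_step k0)[]. Qed.

Lemma run_trial_L_ge k i : (0 < k)%N -> (i <= acc k)%N -> Lmin <= tL (tr k i).
Proof.
move=> k0 ik; rewrite run_L // -[leLHS]mul1r; apply: ler_pM => //.
- exact: ltW.
- by rewrite exprn_ege1 // ltW.
- exact: run_Linit_ge.
Qed.

Lemma run_trial_L_gt0 k i : (0 < k)%N -> (i <= acc k)%N -> 0 < tL (tr k i).
Proof. by move=> k0 ik; exact: lt_le_trans (run_trial_L_ge k0 ik). Qed.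

Lemma run_L_gt0 k : (0 < k)%N -> 0 < L k.
Proof. by move=> k0; exact: run_trial_L_gt0. Qed.

Lemma run_posdef k : (0 < k)%N -> posdef (tD (A k)).
Proof. by move=> k0; case: (run_step k0 (leqnn _)). Qed.

Lemma run_x_in k : Y (x k).
Proof.
elim: k => [|k IH]; first by case: run.
rewrite run_x //; apply: gY.
apply: (step_x_in gproper gconvex (run_step (ltn0Sn k) (leqnn _))) => //.
exact: run_L_gt0.
Qed.

(** The index is positive because the starting point is only known to lie in [Y]; later iterates are
    prox points. *)
Lemma run_x_dom k : (0 < k)%N -> edom g (x k).
Proof.
move=> k0; rewrite run_x //.
apply: (step_x_in gproper gconvex (run_step k0 (leqnn _))) => //.
exact: run_L_gt0.
Qed.

Lemma run_loewner k : (0 < k)%N -> loewner mu%:M (tD (A k)).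
Proof. by move=> k0; apply: (proj1 scaling). Qed.

Lemma run_scaling k u : (0 < k)%N -> Q k.+1 u <= (1 + etas k) * Q k u.
Proof.
move=> k0; rewrite /Q -sqnormD_scalemx; apply: loewner_sqnormD.
exact: (proj2 scaling).
Qed.

Lemma run_mu_le k u : (0 < k)%N -> mu * dotp u u <= Q k u.
Proof.
by move=> k0; rewrite -sqnormD_scalar; apply: loewner_sqnormD; exact: run_loewner.
Qed.

Lemma run_Q_ge0 k u : (0 < k)%N -> 0 <= Q k u.
Proof. by move=> k0; apply: posdef_ge0; exact: run_posdef. Qed.

(** Summability of [etas] bounds the product of the factors [1 + etas k], so the first metric
    dominates all of them. *)
Lemma run_Q_bounded k u : (0 < k)%N -> Q k u <= expR S * Q 1 u.
Proof.
apply: (@exp_bounded_products _ etas (fun k => Q k u) S) => // j j0.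
- exact: run_Q_ge0.
- exact: run_scaling.
Qed.

Lemma run_beta k : (0 < k)%N -> 0 <= tbeta (A k) < 1.
Proof. by move=> k0; case: (run_step k0 (leqnn _)). Qed.

(** Either the first trial is accepted and [L k] is the initial guess, or [L k] is [eta] times a
    rejected value, which is below [2 * Lf / mu]. [Lmin] enters the maximum because the non-monotone
    guess may be reset to it. *)
Lemma run_L_bounded : exists Lmax, forall k, (0 < k)%N -> L k <= Lmax.
Proof.
pose M := Num.max (Num.max (Linit 1) Lmin) (eta * (2 * Lf / mu)).
have M1 : Linit 1 <= M by rewrite !le_max lexx.
have M2 : Lmin <= M by rewrite !le_max lexx orbT.
have M3 : eta * (2 * Lf / mu) <= M by rewrite le_max lexx orbT.
have M0 : 0 <= M by apply: le_trans M2; exact: ltW.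
have LM k : (0 < k)%N -> Linit k <= M -> L k <= M.
  move=> k0 Lk; case E: (acc k) => [|j].
    by rewrite /L /A E run_L ?E // expr0 mul1r.
  have jk : (j < acc k)%N by rewrite E.
  have Lj := run_trial_L_gt0 k0 (ltnW jk).
  have muj : loewner mu%:M (tD (tr k j)) by apply: (proj1 scaling) => //; exact: ltnW.
  have := step_reject fproper fconvex gproper gconvex Yconvex gY Yf fsmooth
    (run_step k0 (ltnW jk)) Lj (run_x_in k.-1) muj mu_gt0 (run_rejects k0 jk).
  rewrite -ltr_pdivlMr // => rej.
  have -> : L k = eta * tL (tr k j).
    by rewrite /L /A run_L // run_L ?(ltnW jk) // E exprS mulrA.
  by apply: le_trans M3; rewrite ler_pM2l // ltW.
exists M; elim=> // -[_ _|k IH _]; first exact: LM.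
apply: LM => //; rewrite Lrule //=.
have Lk : L k.+1 <= M by exact: IH.
case: bt bt_params => [T1 rho|] //= [_ /andP[r0 r1]].
case: ifP => // _; rewrite ge_max M2 andbT; apply: le_trans Lk.
by rewrite ler_piMl // ltW // run_L_gt0.
Qed.

(** * Growth of the momentum and contraction of the extrapolation *)

Definition nonmonotone := exists T1 rho, bt = NonMonotone T1 rho.

(* Under monotone backtracking the momentum ignores the ratio of consecutive
   stepsizes, which is harmless because that ratio is eventually 1. *)
Lemma run_ratio_accounted :
  exists K, forall k, (K <= k)%N -> nonmonotone \/ L k.+1 = L k.
Proof.
have [Lmax HL] := run_L_bounded.
case E: bt => [T1 rho|].
  by exists 0%N => k _; left; exists T1, rho.
have Lk k : L k.+2 = eta ^+ acc k.+2 * L k.+1.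
  by rewrite /L /A run_L // Lrule // E.
have [|K HK] := geometric_jumps_eventually_constant (fun k => L k.+1)
  (fun k => acc k.+2) eta Lmin Lmax eta_gt1 Lmin_gt0 _ Lk.
  by move=> k; rewrite run_trial_L_ge // HL.
by exists K.+1 => -[//|k] kK; right; exact: HK.
Qed.

Lemma run_restart k : (0 < k)%N -> restart_after em tr acc x k ->
  th k.+1 = 1 /\ tbeta (A k.+1) = 0.
Proof.
by move=> k0 r; have := brule k.+1 (acc k.+1) (ltn0Sn k) (leqnn _); rewrite /= r orbT.
Qed.

Lemma run_momentum k : (0 < k)%N -> ~~ restart_after em tr acc x k ->
  th k.+1 = theta_next bt (th k) (L k) (L k.+1) /\
  tbeta (A k.+1) = momentum_factor em * ((th k - 1) / th k.+1).
Proof.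
move=> k0 /negbTE r; have := brule k.+1 (acc k.+1) (ltn0Sn k) (leqnn _).
by rewrite /= r orbF eqSS (gtn_eqF k0).
Qed.

Lemma run_theta1 : th 1 = 1.
Proof. by have [] := brule 1%N (acc 1%N) (ltn0Sn 0) (leqnn _). Qed.

Let ratio_ge0 k : (0 < k)%N -> 0 <= L k.+1 / L k.
Proof. by move=> k0; rewrite divr_ge0 // ltW // run_L_gt0. Qed.

Lemma run_theta_ge1 k : (0 < k)%N -> 1 <= th k.
Proof.
elim: k => // -[_ _|k IH _]; first by rewrite run_theta1.
have [r|r] := boolP (restart_after em tr acc x k.+1).
  by have [->] := run_restart (ltn0Sn k) r.
have [-> _] := run_momentum (ltn0Sn k) r.
case: bt => [T1 rho|]; last first.
  by rewrite theta_next_monotone; have [] := momentum_rootP (th k.+1 ^+ 2) (sqr_ge0 _).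
rewrite theta_next_root; [|by left; exists T1, rho|by rewrite gt_eqF // run_L_gt0].
have [|//] := momentum_rootP (th k.+1 ^+ 2 * (L k.+2 / L k.+1)).
by rewrite mulr_ge0 // ?sqr_ge0 // ratio_ge0.
Qed.

(** Consecutive stepsize ratios are at most [r = Lmax / Lmin], and [r >= 1] gives [r <= r^2], so
    [momentum_root_le] applies with [s = r * th k]. *)
Lemma run_theta_growth : exists2 r : R, 0 <= r &
  forall k, (0 < k)%N -> ~~ restart_after em tr acc x k ->
    th k.+1 <= 1 + r * th k.
Proof.
have [Lmax HL] := run_L_bounded.
have Lm : Lmin <= Lmax by apply: le_trans (HL 1%N _) => //; exact: run_trial_L_ge.
pose r := Lmax / Lmin.
have r1 : 1 <= r by rewrite ler_pdivlMr // mul1r.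
exists r => [|k k0 nr]; first by apply: le_trans r1.
have [-> _] := run_momentum k0 nr; have th1 := run_theta_ge1 k0.
have rt0 : 0 <= r * th k by rewrite mulr_ge0 //; lra.
have rr : L k.+1 / L k <= r.
  apply: ler_pM; [exact/ltW/run_L_gt0|by rewrite invr_ge0 ltW // run_L_gt0|exact: HL|].
  by rewrite lef_pV2 ?posrE ?run_L_gt0 // run_trial_L_ge.
case: bt => [T1 rho|].
  rewrite theta_next_root; [|by left; exists T1, rho|by rewrite gt_eqF // run_L_gt0].
  apply: momentum_root_le => //; first by rewrite mulr_ge0 ?sqr_ge0 // ratio_ge0.
  rewrite exprMn mulrC ler_wpM2r ?sqr_ge0 //; apply: le_trans rr _; nra.
rewrite theta_next_monotone; apply: momentum_root_le => //; first exact: sqr_ge0.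
by rewrite exprMn ler_peMl ?sqr_ge0 //; nra.
Qed.

Lemma run_momentum_contracts : exists2 kappa : R, 0 <= kappa < 1 &
  0 <= momentum_factor em /\
  forall k, (0 < k)%N -> momentum_factor em * (th k - 1) <= kappa * th k.
Proof.
have [r r0 Hr] := run_theta_growth.
have [[delta|s T2] E] : exists e, em = e by exists em.
  rewrite E /=; have := em_params; rewrite E /= => /andP[d0 d1].
  exists delta; first by rewrite ltW.
  by split=> [|k k0]; [exact: ltW | have := run_theta_ge1 k0; nra].
have T20 : (0 < T2)%N by have := em_params; rewrite E.
(* [b j] bounds theta when [j] steps have passed since a periodic restart; the sum [B] of these
   bounds dominates each of them. *)
pose b j := iter j (fun t : R => 1 + r * t) 1.
have b1 j : 1 <= b j.
  by elim: j => //= j IH; rewrite lerDl mulr_ge0 //; lra.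
pose B := \sum_(j < T2) b j.
have bB j : (j < T2)%N -> b j <= B.
  move=> jT; rewrite /B (bigD1 (Ordinal jT)) //= lerDl sumr_ge0 // => i _.
  by apply: le_trans (b1 i).
(* A restart after iteration [k] resets the momentum of index [k.+1], hence the shift. An adaptive
   restart only resets theta to 1, which is below every [b j]. *)
have HB k : th k.+1 <= b (k %% T2)%N.
  elim: k => [|k IH]; first by rewrite run_theta1 mod0n.
  have [rs|nrs] := boolP (restart_after em tr acc x k.+1).
    by have [-> _] := run_restart (ltn0Sn k) rs.
  have -> : (k.+1 %% T2 = (k %% T2).+1)%N.
    (* Both schemes restart at every multiple of [T2], so without a restart the residue grows by
       one. *)
    have : ~~ (T2 %| k.+1)%N.
      by apply: contra nrs; rewrite E /=; case: s {E} => //= ->.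
    by rewrite /dvdn modnS; case: ifP => // ->.
  apply: le_trans (Hr _ (ltn0Sn k) nrs) _.
  by rewrite /= lerD2l ler_wpM2l.
have B1 : 1 <= B by apply: le_trans (bB 0%N T20).
have B0 : 0 < B by lra.
have iB : 0 < B^-1 <= 1 by rewrite invr_gt0 B0 invf_le1.
have BB : B^-1 * B = 1 by rewrite mulVf // gt_eqF.
(* The inequality [t - 1 <= (1 - 1 / B) t] is equivalent to [t <= B]. *)
exists (1 - B^-1); first lra.
rewrite E /=; split=> // -[//|k] _; rewrite mul1r mulrBl mul1r.
have : th k.+1 <= B by apply: le_trans (HB k) _; rewrite bB // ltn_mod.
nra.
Qed.

Lemma run_extrapolation_contracts : exists2 kappa : R, 0 <= kappa < 1 &
  exists K, forall k, (K <= k)%N ->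
    L k.+1 * tbeta (A k.+1) ^+ 2 <= kappa ^+ 2 * L k.
Proof.
have [kappa kappa1 [m0 Hk]] := run_momentum_contracts.
have [K HK] := run_ratio_accounted.
exists kappa => //; exists K.+1 => -[//|k] kK.
have [r|r] := boolP (restart_after em tr acc x k.+1).
  have [_ ->] := run_restart (ltn0Sn k) r.
  by rewrite expr0n mulr0 mulr_ge0 ?sqr_ge0 // ltW // run_L_gt0.
have [tE ->] := run_momentum (ltn0Sn k) r.
rewrite tE theta_next_root; [|exact/HK/ltnW|by rewrite gt_eqF // run_L_gt0].
by apply: momentum_sqr_le; rewrite ?run_L_gt0 ?run_theta_ge1 // Hk.
Qed.

(** * Eventual descent of the objective *)

Lemma etas_cvg0 : etas k @[k --> \oo] --> (0 : R).
Proof. exact: summable_cvg0 etas_ge0 etas_sum. Qed.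

Lemma run_descent k : (0 < k)%N ->
  F k.+1 + a k.+1 <= F k + L k.+1 / 2 * (tbeta (A k.+1) ^+ 2 * Q k.+1 (x k - x k.-1)).
Proof.
move=> k0; have := step_descent fproper fconvex gproper gconvex Yconvex gY Yf
  fsmooth (run_step (ltn0Sn k) (leqnn _)) (run_L_gt0 (ltn0Sn k)) (run_x_in k)
  (run_accepts (ltn0Sn k)) (run_subdiff (ltn0Sn k)) (run_x_dom k0).
by rewrite /F /a /Q /= [x k.+1]run_x.
Qed.

Lemma run_decrease : exists2 c : R, 0 <= c < 1 & exists K, forall k, (K <= k)%N ->
  0 <= a k /\ F k.+1 + a k.+1 <= F k + c * a k.
Proof.
have [kappa /andP[kappa0 kappa1] [K HK]] := run_extrapolation_contracts.
have k1 : kappa ^+ 2 < 1 by rewrite expr_lt1.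
have e0 : 0 < (1 - kappa ^+ 2) / 2 by lra.
have [K' _ HK'] := cvgr_lt _ etas_cvg0 _ e0.
(* The midpoint between [kappa^2] and 1: once [etas k < (1 - kappa^2) / 2], the factor
   [kappa^2 (1 + etas k)] is below it. *)
exists ((1 + kappa ^+ 2) / 2); first by have := sqr_ge0 kappa; lra.
exists (maxn 1 (maxn K K')) => k; rewrite !geq_max => /and3P[k0 kK kK'].
have a0 : 0 <= a k.
  by rewrite mulr_ge0 ?run_Q_ge0 // divr_ge0 // ltW // run_L_gt0.
split=> //; apply: le_trans (run_descent k0) _; rewrite lerD2l.
have q0 := run_Q_ge0 (x k - x k.-1) k0.
have qS := run_scaling (x k - x k.-1) k0.
have b0 : 0 <= L k.+1 * tbeta (A k.+1) ^+ 2.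
  by rewrite mulr_ge0 ?sqr_ge0 // ltW // run_L_gt0.
have et0 := etas_ge0 k k0; have := HK' _ kK' => /= et1.
have bK := HK _ kK.
set q := Q k _ in q0 qS; set q' := Q k.+1 _ in qS *.
have s1 : L k.+1 * tbeta (A k.+1) ^+ 2 * q' <=
    kappa ^+ 2 * L k * ((1 + etas k) * q).
  apply: ler_pM => //; exact: run_Q_ge0.
have s2 : kappa ^+ 2 * (1 + etas k) <= (1 + kappa ^+ 2) / 2.
  by have := sqr_ge0 kappa; nra.
have s3 := ler_wpM2r a0 s2.
by rewrite /a -/q in s3 *; lra.
Qed.

(** * Convergence of the objective values and of the increments *)

Context (Fstar : R) (F_ge : forall z, (Fstar%:E <= objective f g h z)%E).

Lemma run_objectiveE k : (0 < k)%N -> objective f g h (x k) = (F k)%:E.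
Proof.
move=> k0; apply: (objectiveE h fproper gproper gY Yf); exact: run_x_dom.
Qed.

Lemma run_F_cvg : (exists l : R, F k @[k --> \oo] --> l) /\
  a k @[k --> \oo] --> (0 : R).
Proof.
have [c c01 [K HK]] := run_decrease.
apply: (@descent_cvg R F a c Fstar c01); exists K.+1 => -[//|k] kK.
have [a0 dec] := HK _ (ltnW kK); split=> //.
by rewrite -lee_fin -run_objectiveE.
Qed.

Lemma run_objective_cvg :
  (* The limit is taken from index 1 on, since the objective may be infinite at the starting
     point. *)
  exists l : R, objective f g h (x k) @[k --> \oo] --> l%:E.
Proof.
have [[l Fl] _] := run_F_cvg; exists l; rewrite -cvg_shiftS.
have -> : [sequence objective f g h (x k.+1)]_k = EFin \o (fun k => F k.+1).
  by apply/funext => k; rewrite /= run_objectiveE.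
apply: cvg_EFin; first exact: nearW.
by rewrite -cvg_shiftS in Fl.
Qed.

Lemma run_Q_increment_cvg0 : Q k (x k - x k.-1) @[k --> \oo] --> (0 : R).
Proof.
have [_ a0] := run_F_cvg.
have lim : 2 / Lmin * a k @[k --> \oo] --> (0 : R).
  by rewrite -(mulr0 (2 / Lmin)); apply: cvgMl_tmp.
apply: (squeeze_cvgr _ (cvg_cst (0 : R)) lim); near=> k.
have k0 : (0 < k)%N by near: k; exists 1%N.
have q0 := run_Q_ge0 (x k - x k.-1) k0; rewrite q0 /= /a.
have -> : 2 / Lmin * (L k / 2 * Q k (x k - x k.-1)) =
    L k / Lmin * Q k (x k - x k.-1) by field; rewrite gt_eqF.
by rewrite ler_peMl // ler_pdivlMr // mul1r run_trial_L_ge.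
Unshelve. all: by end_near. Qed.

Lemma run_increment_cvg0 : enorm (x k.+1 - x k) @[k --> \oo] --> (0 : R).
Proof.
apply: sqnorm_cvg0; have := run_Q_increment_cvg0; rewrite -cvg_shiftS => q0.
have lim : mu^-1 * Q k.+1 (x k.+1 - x k) @[k --> \oo] --> (0 : R).
  by rewrite -(mulr0 mu^-1); apply: cvgMl_tmp.
apply: (squeeze_cvgr _ (cvg_cst (0 : R)) lim); apply: nearW => k.
by rewrite dotp_ge0 /= ler_pdivlMl // run_mu_le.
Qed.

(** Insert the previous iterate. The extrapolated point is no farther from it than the last
    increment, as the projection is nonexpansive and beta is below 1; changing the metric costs
    [1 + etas k], eventually at most 2. *)
Lemma run_Q_step_cvg0 : Q k (ty (A k) - x k) @[k --> \oo] --> (0 : R).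
Proof.
have q0 := run_Q_increment_cvg0.
rewrite -cvg_shiftS /=.
have lim : 2 * (2 * Q k (x k - x k.-1) + Q k.+1 (x k.+1 - x k))
    @[k --> \oo] --> (0 : R).
  have -> : (0 : R) = 2 * (2 * 0 + 0) by ring.
  apply: cvgMl_tmp; apply: cvgD; first exact: cvgMl_tmp.
  by have := q0; rewrite -cvg_shiftS.
apply: (squeeze_cvgr _ (cvg_cst (0 : R)) lim); near=> k.
have k0 : (0 < k)%N by near: k; exists 1%N.
rewrite run_Q_ge0 //=.
have -> : ty (A k.+1) - x k.+1 = (ty (A k.+1) - x k) + (x k - x k.+1).
  by rewrite addrA subrK.
apply: le_trans (sqnormDD_le _ _ _ (run_posdef (ltn0Sn k))) _.
rewrite ler_pM2l // [sqnormD _ (x k - _)]sqnormDC lerD2r.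
apply: le_trans (step_y_dist Yconvex (run_step (ltn0Sn k) (leqnn _)) (run_x_in k)) _.
have /andP[b0 b1] := run_beta (ltn0Sn k).
have b2 : tbeta (A k.+1) ^+ 2 <= 1 by rewrite expr_le1 // ltW.
have qk := run_Q_ge0 (x k - x k.-1) (ltn0Sn k).
apply: le_trans (_ : Q k.+1 (x k - x k.-1) <= _).
  by rewrite ler_piMl.
apply: le_trans (run_scaling _ k0) _.
have e1 : etas k <= 1.
  by near: k; apply: (cvgr_le _ etas_cvg0); exact: ltr01.
by rewrite ler_wpM2r ?run_Q_ge0 //; lra.
Unshelve. all: by end_near. Qed.

Context (Yclosed : closed Y) (gclosed : eclosed g).
Context (hconvex : convex_function [set: 'rV[R]_n] h).

(** * Limits along an ultrafilter and criticality of the limit point *)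

Section LimitPoint.
Context (U : set_system nat) {UU : UltraFilter U} (Uoo : \oo `<=` U).
Context (xbar : 'rV[R]_n) (x_cvg : x k @[k --> U] --> xbar).

Let pos_near : \forall k \near U, (0 < k)%N.
Proof. by apply: Uoo; exists 1%N. Qed.

Let xbar_in : Y xbar.
Proof. by apply: (closed_cvg Y Yclosed _ _ x_cvg); apply: nearW => k; exact: run_x_in. Qed.

Lemma predecessor_cvg : x k.-1 @[k --> U] --> xbar.
Proof.
have d0 : x k - x k.-1 @[k --> U] --> (0 : 'rV[R]_n).
  apply: enorm_cvg0; apply: cvg_trans (_ : enorm (x k - x k.-1) @[k --> \oo] --> (0 : R)).
    exact: cvg_app.
  by rewrite -cvg_shiftS; exact: run_increment_cvg0.
have -> : (fun k => x k.-1) = (fun k => x k - (x k - x k.-1)).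
  by apply/funext => k; rewrite subKr.
by rewrite -(subr0 xbar); apply: cvgB.
Qed.

Lemma extrapolated_cvg : ty (A k) @[k --> U] --> xbar.
Proof.
have d0 : ty (A k) - x k @[k --> U] --> (0 : 'rV[R]_n).
  apply: enorm_cvg0; apply: sqnorm_cvg0.
  have lim : mu^-1 * Q k (ty (A k) - x k) @[k --> U] --> (0 : R).
    rewrite -(mulr0 mu^-1); apply: cvgMl_tmp.
    exact: cvg_trans (cvg_app _ Uoo) run_Q_step_cvg0.
  apply: (squeeze_cvgr _ (cvg_cst (0 : R)) lim).
  near=> k; have k0 : (0 < k)%N by near: k.
  by rewrite dotp_ge0 /= ler_pdivlMl // run_mu_le.
have -> : (fun k => ty (A k)) = (fun k => (ty (A k) - x k) + x k).
  by apply/funext => k; rewrite subrK.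
by rewrite -(add0r xbar); apply: cvgD.
Unshelve. all: by end_near. Qed.

(** The Lipschitz bound holds on [Y], which contains the extrapolated points and, being closed,
    [xbar]. *)
Lemma grad_extrapolated_cvg : grad f (ty (A k)) @[k --> U] --> grad f xbar.
Proof.
apply: cvgB0P; apply: enorm_cvg0.
have lim : Lf * enorm (ty (A k) - xbar) @[k --> U] --> (0 : R).
  rewrite -(mulr0 Lf); apply: cvgMl_tmp.
  have -> : (0 : R) = enorm (xbar - xbar).
    by rewrite subrr /enorm dotp0r sqrtr0.
  by apply: cvg_enorm; apply: cvgB; [exact: extrapolated_cvg | exact: cvg_cst].
apply: (squeeze_cvgr _ (cvg_cst (0 : R)) lim).
near=> k; have k0 : (0 < k)%N by near: k.
rewrite enorm_ge0 /=; have [_ lip] := fsmooth; apply: lip => //.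
exact: (step_y_in Yconvex (run_step k0 (leqnn _)) (run_x_in k.-1)).
Unshelve. all: by end_near. Qed.

(** The subgradients eventually stay in a compact ball, and a cluster point along an ultrafilter is
    a limit; no further subsequence has to be extracted. *)
Lemma subgradients_cvg : exists v : 'rV[R]_n, hs k.-1 @[k --> U] --> v.
Proof.
have [B HB] := subdiff_bounded _ hconvex xbar.
pose C := [set v : 'rV[R]_n | `|v| <= B].
have Cc : compact C.
  apply: bounded_closed_compact.
    by exists B; split=> [|M BM v /= vB]; [exact: num_real | exact: le_trans (ltW BM)].
  have -> : C = (fun v : 'rV[R]_n => `|v|) @^-1` [set y | y <= B] by [].
  apply: closed_comp => [v _|]; [exact: norm_continuous | exact: closed_le].
have UC : (hs k.-1 @[k --> U]) C.
  have d0 : `|x k.-1 - xbar| @[k --> U] --> (0 : R).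
    rewrite -(normr0 'rV[R]_n) -(subrr xbar); apply: cvg_norm.
    by apply: cvgB; [exact: predecessor_cvg | exact: cvg_cst].
  rewrite /nbhs /=; near=> k.
  apply: (HB (x k.-1)); last by apply: run_subdiff; near: k.
  by near: k; apply: (cvgr_le _ d0); rewrite invr_gt0.
have [v [_ clv]] := Cc _ _ UC; exists v => N vN.
(* If the preimage of [N] were not in [U], its complement would be, contradicting that [v] is a
   cluster point. *)
have [//|UN] := in_ultra_setVsetC [set k | N (hs k.-1)] UU.
by have [w [/= nw /nw]] := clv (~` N) N UN vN.
Unshelve. all: by end_near. Qed.

(** Cauchy-Schwarz in the metric of iteration [k] bounds the square by [b k]: one factor tends to 0,
    and the other, compared with the first metric, converges. *)
Lemma scaled_step_cvg0 w :
  dotp (L k *: ((ty (A k) - x k) *m tD (A k))) (w - x k) @[k --> U] --> (0 : R).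
Proof.
have [Lmax HL] := run_L_bounded.
have q0 : Q k (ty (A k) - x k) @[k --> U] --> (0 : R).
  exact: cvg_trans (cvg_app _ Uoo) run_Q_step_cvg0.
have e1 : Q 1 (w - x k) @[k --> U] --> Q 1 (w - xbar).
  by apply: cvg_sqnormD; apply: cvgB => //; exact: cvg_cst.
pose b k := Lmax ^+ 2 * (Q k (ty (A k) - x k) * (expR S * Q 1 (w - x k))).
have b0 : Num.sqrt (b k) @[k --> U] --> (0 : R).
  rewrite -(sqrtr0 R); apply: (cvg_comp b Num.sqrt); last exact: sqrt_continuous.
  have -> : (0 : R) = Lmax ^+ 2 * (0 * (expR S * Q 1 (w - xbar))) by ring.
  by apply: cvgMl_tmp; apply: cvgM => //; apply: cvgMl_tmp.
apply: norm_cvg0; apply: (squeeze_cvgr _ (cvg_cst (0 : R)) b0).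
near=> k; have k0 : (0 < k)%N by near: k.
rewrite normr_ge0 /= -sqrtr_sqr ler_wsqrtr // dotpZl exprMn.
have Lk := run_L_gt0 k0.
apply: ler_pM; rewrite ?sqr_ge0 //.
  by rewrite ler_pXn2r ?nnegrE ?HL // ltW // (lt_le_trans Lk) ?HL.
apply: le_trans (posdef_cauchy_schwarz _ _ _ (run_posdef k0)) _.
by rewrite ler_wpM2l ?run_Q_ge0 // run_Q_bounded.
Unshelve. all: by end_near. Qed.

Lemma limit_critical : critical f g h xbar.
Proof.
have [v hv] := subgradients_cvg.
have gN u : g u != -oo%E by case: gproper => + _; exact.
have gsub w : edom g w ->
    (g xbar <= (fine (g w) - dotp (v - grad f xbar) (w - xbar))%:E)%E.
  (* [step_prox] says that [(x k, r k)] lies in the epigraph of [g]; its closedness yields the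
     inequality at [xbar] before [g xbar] is known to be finite. *)
  move=> gw; pose r k := fine (g w)
    - (dotp (L k *: ((ty (A k) - x k) *m tD (A k))) (w - x k)
       - dotp (grad f (ty (A k)) - hs k.-1) (w - x k)).
  have rl : r k @[k --> U] --> fine (g w) - dotp (v - grad f xbar) (w - xbar).
    apply: cvgB; first exact: cvg_cst.
    rewrite -(opprB _ v) dotpNl -[X in _ --> X]add0r.
    apply: cvgB; first exact: scaled_step_cvg0.
    apply: cvg_dotp; apply: cvgB => //; [exact: grad_extrapolated_cvg|exact: cvg_cst].
  have xr : (x k, r k) @[k --> U] -->
      (xbar, fine (g w) - dotp (v - grad f xbar) (w - xbar)) by exact: (cvg_pair x_cvg rl).
  apply: (closed_cvg _ gclosed _ _ xr) => /=.
  near=> k; have k0 : (0 < k)%N by near: k.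
  have [gx] := step_prox gproper gconvex (run_step k0 (leqnn _)) (run_L_gt0 k0) gw.
  rewrite -run_x // in gx * => H.
  by rewrite /= -(edom_fineK _ _ gN gx) lee_fin /r -dotpNl -dotpDl; lra.
exists (v - grad f xbar), v; split.
- have gx : edom g xbar.
    (* Any point of the domain of [g] gives a finite upper bound for [g xbar]. *)
    by case: gproper => _ [w /gsub gw]; apply: le_lt_trans gw _; rewrite ltry.
  split=> // w; have [gw|] := boolP (g w < +oo)%E; last first.
    by rewrite -leNgt leye_eq => /eqP->; rewrite leey.
  have := gsub w gw; rewrite -(edom_fineK _ _ gN gw) -(edom_fineK _ _ gN gx).
  by rewrite -EFinD !lee_fin; lra.
- have sub : \forall k \near U, subdiff (EFin \o h) (x k.-1) (hs k.-1).
    by near=> k; apply: run_subdiff; near: k.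
  exact: (subdiff_cvg _ hconvex _ _ _ _ _ sub predecessor_cvg hv).
- by rewrite subrKC subrr.
Unshelve. all: by end_near. Qed.

End LimitPoint.

End Run.

Theorem theorem4p1 (R : realType) (n : nat)
  (f g : 'rV[R]_n -> \bar R) (h : 'rV[R]_n -> R) (Y : set 'rV[R]_n) (Lf : R)
  (fproper : eproper f) (fconvex : econvex f)
  (gproper : eproper g) (gconvex : econvex g) (gclosed : eclosed g)
  (hconvex : convex_function [set: 'rV[R]_n] h)
  (Ynonempty : Y !=set0) (Yclosed : closed Y)
  (Yconvex : convex_set (Y : set (convex_lmodType 'rV[R]_n)))
  (gY : edom g `<=` Y) (Yf : Y `<=` interior (edom f))
  (fsmooth : smooth_on f Lf Y)
  (Fbounded : exists Fstar : R, forall z, (Fstar%:E <= objective f g h z)%E)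
  (eta Lmin : R) (eta_gt1 : 1 < eta) (Lmin_gt0 : 0 < Lmin)
  (bt : backtracking R) (em : extrapolation R)
  (bt_params : backtracking_params bt) (em_params : extrapolation_params em)
  (Linit : nat -> R) (hs : nat -> 'rV[R]_n)
  (tr : nat -> nat -> trial R n) (acc : nat -> nat) (x : nat -> 'rV[R]_n)
  (run : spdcae f g h Y eta Lmin Linit hs tr acc x)
  (Lrule : Linit_rule bt Lmin Linit tr acc)
  (brule : beta_rule bt em tr acc x)
  (mu : R) (mu_gt0 : 0 < mu) (etas : nat -> R)
  (etas_ge0 : forall k, (0 < k)%N -> 0 <= etas k)
  (etas_sum : (\sum_(1 <= k <oo) (etas k)%:E < +oo)%E)
  (scaling : scaling_condition mu etas tr acc) :
  ((exists l : R, objective f g h (x k) @[k --> \oo] --> l%:E) /\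
   (enorm (x k.+1 - x k) @[k --> \oo] --> 0)) /\
  ((exists M : R, forall k, enorm (x k) <= M) ->
   forall xbar : 'rV[R]_n,
     (exists s : nat -> nat, increasing_seq s /\ x (s k) @[k --> \oo] --> xbar) ->
     critical f g h xbar).
Proof.
have [S HS] := summable_partial_sums_bounded _ etas_ge0 etas_sum.
have [Fstar F_ge] := Fbounded.
split; first split.
- exact: (run_objective_cvg fproper fconvex gproper gconvex Yconvex gY Yf fsmooth
    eta_gt1 Lmin_gt0 bt_params em_params run Lrule brule mu_gt0 etas_ge0 HS scaling F_ge).
- exact: (run_increment_cvg0 fproper fconvex gproper gconvex Yconvex gY Yf fsmooth
    eta_gt1 Lmin_gt0 bt_params em_params run Lrule brule mu_gt0 etas_ge0 HS scaling F_ge).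
move=> _ xbar [s [s_incr s_cvg]].
(* [U] refines the image under [s] of the filter at infinity, so the convergence of the subsequence
   becomes convergence of [x] itself along [U]. Since [s k >= k], [U] also refines the filter at
   infinity. *)
have [U [UU sU]] := ultraFilterLemma (fmap_proper_filter s (eventually_filter)).
have s_ge k : (k <= s k)%N.
  elim: k => // k IH; apply: leq_ltn_trans IH _.
  by have /increasing_seqP := s_incr; apply.
have Uoo : \oo `<=` U.
  move=> A [N _ NA]; apply: sU; exists N => // k /= Nk.
  exact/NA/(leq_trans Nk).
have x_cvg : x k @[k --> U] --> xbar by move=> A /s_cvg; exact: sU.
exact: (limit_critical fproper fconvex gproper gconvex Yconvex gY Yf fsmooth
    eta_gt1 Lmin_gt0 bt_params em_params run Lrule brule mu_gt0 etas_ge0 HS scaling F_ge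
    Yclosed gclosed hconvex Uoo x_cvg).
Qed.
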